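(* Let $X$ be a complex Banach space and $2\le q<\infty$. If $X$ has cotype $q$ and local unconditional structure, then $X$ has hypercontractive homogeneous cotype $q$.
   Context: $\mathbb{T}=\{z\in\mathbb{C}:|z|=1\}$; $\mathbb{T}^N$ and $\mathbb{T}^\infty$ carry the product of the normalized Lebesgue measure on $\mathbb{T}$, denoted $dz$. $\mathbb{N}_0^{(\mathbb{N})}$ is the set of finite multi-indices $\alpha=(\alpha_1,\alpha_2,\dots)$ of nonnegative integers of arbitrary length (finitely many nonzero entries); $|\alpha|=\alpha_1+\alpha_2+\cdots$ and $z^\alpha=z_1^{\alpha_1}z_2^{\alpha_2}\cdots$. A finite family is a family with only finitely many nonzero elements. Cotype: $X$ has cotype $q$ if there is $C>0$ such that for all $N$ and $x_1,\dots,x_N\in X$, $$\Big(\sum_{k=1}^N\|x_k\|^q\Big)^{1/q}\le C\Big(\int_{\mathbb{T}^N}\Big\|\sum_{k=1}^N x_kz_k\Big\|^2dz\Big)^{1/2}.$$ Hypercontractive homogeneous cotype: $X$ has hypercontractive homogeneous cotype $q$ if there is $C>0$ such that for every $m\in\mathbb{N}$ and every finite family $(x_\alpha)_{|\alpha|=m}\subset X$, indexed by $\alpha\in\mathbb{N}_0^{(\mathbb{N})}$ with $|\alpha|=m$, $$\Big(\sum_{|\alpha|=m}\|x_\alpha\|^q\Big)^{1/q}\le C^m\Big(\int_{\mathbb{T}^\infty}\Big\|\sum_{|\alpha|=m}x_\alpha z^\alpha\Big\|^2dz\Big)^{1/2}.$$ Local unconditional structure (l.u.st.): there is $\lambda>0$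 such that for every finite dimensional subspace $F$ of $X$ there exist a Banach space $U$ with an unconditional basis $\{u_n\}$ and bounded operators $T:F\to U$, $S:U\to X$ such that $ST$ is the inclusion map $F\hookrightarrow X$ and $\|T\|\cdot\|S\|\cdot\chi\{u_n\}\le\lambda$, where $\chi\{u_n\}$ is the unconditional basis constant of $\{u_n\}$. *)

(* Defs.v *)
From HB Require Import structures.
From mathcomp Require Import all_boot all_order all_algebra finmap.
From mathcomp Require Import all_classical all_reals all_analysis.
From mathcomp Require Import measurable_realfun lra ring.
From mathcomp Require Import complex.

Set Implicit Arguments.
Unset Strict Implicit.
Unset Printing Implicit Defensive.

Import Order.TTheory GRing.Theory Num.Theory numFieldNormedType.Exports.
Local Open Scope classical_set_scope.
Local Open Scope ring_scope.

(* The library has no infinite products of probability measures. The binary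
   digits of a uniform variable on [0, 1], split by parity into two numbers,
   give two independent uniform variables (EO_prod); iterating this produces
   the i.i.d. uniform sequence unif_seq. *)
Module UniformSequence.
Section uniform_sequence.
Context (R : realType).
Notation RR := (measurableTypeR R).
Let P : probability RR R := uniform_prob (@ltr01 R).

Lemma P_E (A : set RR) : measurable A ->
  P A = lebesgue_measure (A `&` `[0, 1]%classic).
Proof.
move=> mA; rewrite /P/= /uniform_prob integral_uniform_pdf.
have mA1 : measurable (A `&` `[0, 1]%classic : set RR).
  by apply: measurableI => //; exact: measurable_itv.
rewrite (eq_integral (cst 1%E)); last first.
  move=> x; rewrite inE /= => -[_]; rewrite in_itv/= /uniform_pdf => ->.
  by rewrite subr0 invr1.
by rewrite integral_cst// mul1e.
Qed.

Lemma ray_unique (m1 m2 : {measure set RR -> \bar R}) :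
  (forall x, m1 `]x, +oo[%classic = m2 `]x, +oo[%classic) ->
  (forall x, (m1 `]x, +oo[%classic < +oo)%E) ->
  forall A, measurable A -> m1 A = m2 A.
Proof.
move=> m12 m1oo A mA.
have := @measure_unique _ R RR (@measurable_realfun.RGenOInfty.G R : set (set RR)) (fun k : nat => `]- k%:R, +oo[%classic : set RR) _ _ _ _ m1 m2 _ _ A mA. apply.
- exact: measurable_realfun.RGenOInfty.measurableE.
- move=> _ _ [x ->] [y ->]; exists (Num.max x y).
  by apply/seteqP; split => t /=; rewrite !in_itv/= !andbT gt_max => /andP.
- by move=> i; eexists.
- rewrite -subTset => x _; exists (Num.trunc `|x|).+1 => //=.
  rewrite in_itv/= andbT ltrNl.
  by apply: le_lt_trans (truncnS_gt _); rewrite -normrN ler_norm.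
- by move=> _ [x ->].
- by move=> k; exact: m1oo.
Qed.

Definition bit (t : R) : bool := 2^-1 <= t.
Definition shift (t : R) : R := 2 * t - (bit t)%:R.

Lemma measurable_bit : measurable_fun setT (bit : RR -> bool).
Proof. exact: measurable_fun_ler. Qed.

Lemma measurable_bitR : measurable_fun setT ((fun t => (bit t)%:R) : RR -> RR).
Proof.
rewrite (_ : (fun t => _) = fun t => if bit t then 1 else 0 : R); last first.
  by apply/funext => t; case: (bit t).
by apply: measurable_fun_ifT => //; exact: measurable_bit.
Qed.

Lemma measurable_shift : measurable_fun setT (shift : RR -> RR).
Proof.
apply: measurable_funB; last exact: measurable_bitR.
exact: measurable_funM.
Qed.

Lemma measurable_bit_eq u : measurable ([set t | bit t = u] : set RR).
Proof.
rewrite (_ : [set _ | _] = setT `&` bit @^-1` [set u]); last by rewrite setTI.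
exact: measurable_bit.
Qed.

Lemma pushm d1 d2 (T1 : measurableType d1) (T2 : measurableType d2)
    (m : {measure set T1 -> \bar R}) (f : T1 -> T2) : measurable_fun setT f ->
  exists m' : {measure set T2 -> \bar R}, forall A, m' A = m (f @^-1` A).
Proof.
move=> mf; unshelve eexists.
  by refine (pushforward m f : {measure set T2 -> \bar R}).
by [].
Qed.

Lemma P_ray x : P `]x, +oo[%classic =
  (if x < 0 then 1 else if x < 1 then 1 - x else 0)%:E.
Proof.
rewrite P_E; last exact: measurable_itv.
case: ltP => x0; last case: ltP => x1.
- rewrite (_ : _ `&` _ = `[0, 1]%classic).
    by rewrite lebesgue_measure_itv/= lte_fin ltr01 -EFinD subr0.
  by apply/seteqP; split => t /=; rewrite !in_itv/= => ?; (try split); lra.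
- rewrite (_ : _ `&` _ = `]x, 1]%classic).
    by rewrite lebesgue_measure_itv/= lte_fin x1 -EFinD.
  by apply/seteqP; split => t /=; rewrite !in_itv/= => ?; (try split); lra.
- rewrite (_ : _ `&` _ = set0) ?measure0//.
  by apply/seteqP; split => t //=; rewrite !in_itv/= => ?; lra.
Qed.

Lemma half u (A : set RR) : measurable A ->
  P [set t | bit t = u /\ A (shift t)] = (2^-1%:E * P A)%E.
Proof.
move=> mA.
have mD : measurable ([set t | bit t = u] : set RR) := measurable_bit_eq u.
have [m1 m1E] := pushm (mrestr P mD) measurable_shift.
have h0 : 0 <= 2^-1 :> R by [].
pose m2 : {measure set RR -> \bar R} := mscale (NngNum h0) P.
have E (B : set RR) : m1 B = P [set t | bit t = u /\ B (shift t)].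
  by rewrite m1E /mrestr; congr (P _); apply/seteqP; split=> t [].
rewrite -E; apply: (@ray_unique m1 m2) => // x.
  rewrite E (_ : m2 _ = (2^-1%:E * P `]x, +oo[%classic)%E)//.
  rewrite P_ray P_E; last first.
    apply: measurableI => //; rewrite -[X in measurable X]setTI.
    by apply: measurable_shift => //; exact: measurable_itv.
  rewrite -EFinM.
  have bE t : (bit t = u) = (if u then 2^-1 <= t else t < 2^-1).
    apply/propext; by rewrite /bit; case: u {mD m1 m1E m2 E}; case: ltP.
  have [u1|u0] := boolP u.
    have tE t : 2^-1 <= t -> shift t = 2 * t - 1.
      by rewrite /shift/bit => ->.
    have bE' t : (bit t = true) = (2^-1 <= t : Prop) by rewrite -[true]u1 bE u1.
    case: ltP => x0; last case: ltP => x1.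
    - rewrite (_ : _ `&` _ = `[2^-1, 1]%classic).
        by rewrite lebesgue_measure_itv/= lte_fin ifT -?EFinD//; try (congr _%:E); lra.
      apply/seteqP; split => t /=; rewrite !in_itv/= bE'.
        by move=> [[? _] ?]; lra.
      by move=> ?; rewrite tE; [split; [split|]|]; lra.
    - rewrite (_ : _ `&` _ = `](x + 1) / 2, 1]%classic).
        by rewrite lebesgue_measure_itv/= lte_fin ifT -?EFinD//; try (congr _%:E); lra.
      apply/seteqP; split => t /=; rewrite !in_itv/= bE'.
        by move=> [[/[dup] ? /tE ->] ? ?]; lra.
      by move=> ?; rewrite tE; [split; [split|]|]; lra.
    - rewrite (_ : _ `&` _ = set0) ?measure0 ?mulr0//.
      apply/seteqP; split => t //=; rewrite !in_itv/= bE'.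
      by move=> [[/[dup] ? /tE ->] ? ?]; lra.
  have tE t : t < 2^-1 -> shift t = 2 * t.
    by rewrite /shift/bit; case: ltP => // _ _; rewrite subr0.
  have bE' t : (bit t = false) = (t < 2^-1 : Prop) by rewrite -(negbTE u0) bE (negbTE u0).
  case: ltP => x0; last case: ltP => x1.
  - rewrite (_ : _ `&` _ = `[0, 2^-1[%classic).
      by rewrite lebesgue_measure_itv/= lte_fin ifT -?EFinD//; try (congr _%:E); lra.
    apply/seteqP; split => t /=; rewrite !in_itv/= bE'.
      by move=> [[? _] ?]; lra.
    by move=> ?; rewrite tE; [split; [split|]|]; lra.
  - rewrite (_ : _ `&` _ = `]x / 2, 2^-1[%classic).
      by rewrite lebesgue_measure_itv/= lte_fin ifT -?EFinD//; try (congr _%:E); lra.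
    apply/seteqP; split => t /=; rewrite !in_itv/= bE'.
      by move=> [[/[dup] ? /tE ->] ? ?]; lra.
    by move=> ?; rewrite tE; [split; [split|]|]; lra.
  - rewrite (_ : _ `&` _ = set0) ?measure0 ?mulr0//.
    apply/seteqP; split => t //=; rewrite !in_itv/= bE'.
    by move=> [[/[dup] ? /tE ->] ? ?]; lra.
by rewrite E; apply: le_lt_trans (ltry 1); apply: probability_le1;
  apply: measurableI => //; rewrite -[X in measurable X]setTI;
  apply: measurable_shift => //; exact: measurable_itv.
Qed.

Fixpoint dig (p s : R -> R) (k : nat) (t : R) : R :=
  if k is k'.+1 then (bit (p t))%:R / 2 + dig p s k' (s t) / 2 else 0.

Lemma dig_bound p s k t : 0 <= dig p s k t <= 1.
Proof.
elim: k t => [|k IH] t /=; first by rewrite lexx ler01.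
by have := IH (s t); case: (bit _) => /=; lra.
Qed.

Lemma dig_nd p s t : nondecreasing_seq (dig p s ^~ t).
Proof.
apply/nondecreasing_seqP => k; elim: k t => [|k IH] t.
  by have /andP[] := dig_bound p s 1 t.
have := IH (s t); rewrite [dig p s k.+2 t]/= [dig p s k.+1 t]/=.
rewrite -/(dig p s k.+1 (s t)); lra.
Qed.

Definition dlim p s (t : R) : R := sup (range (dig p s ^~ t)).

Lemma dig_cvg p s t : dig p s ^~ t @ \oo --> dlim p s t.
Proof.
apply: nondecreasing_cvgn; first exact: dig_nd.
by exists 1 => _ [k _ <-]; have /andP[] := dig_bound p s k t.
Qed.

Lemma dlimP p s x t : x < dlim p s t <-> exists k, x < dig p s k t.
Proof.
have hs : has_sup (range (dig p s ^~ t)).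
  split; first by exists (dig p s 0 t), 0%N.
  by exists 1 => _ [k _ <-]; have /andP[] := dig_bound p s k t.
split=> [|[k xk]]; last first.
  by apply: lt_le_trans xk _; apply: ub_le_sup; [case: hs|exists k].
move=> xl; have d0 : 0 < dlim p s t - x by rewrite subr_gt0.
have [_ [k _ <-] H] := sup_adherent d0 hs.
by exists k; move: H; rewrite /dlim; lra.
Qed.

Lemma measurable_dig p s k : measurable_fun setT (p : RR -> RR) ->
  measurable_fun setT (s : RR -> RR) ->
  measurable_fun setT (dig p s k : RR -> RR).
Proof.
move=> mp ms; elim: k => [|k IH] /=; first exact: measurable_cst.
apply: measurable_funD; apply: measurable_funM => //.
- exact: (measurableT_comp measurable_bitR mp).
- exact: (measurableT_comp IH ms).
Qed.

Lemma measurable_dlim p s : measurable_fun setT (p : RR -> RR) ->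
  measurable_fun setT (s : RR -> RR) ->
  measurable_fun setT (dlim p s : RR -> RR).
Proof.
move=> mp ms; apply: (measurable_fun_cvg (h := dig p s)) => [k|t _].
  exact: measurable_dig.
exact: dig_cvg.
Qed.

Lemma mray (f : R -> R) x : measurable_fun setT (f : RR -> RR) ->
  measurable ([set t | x < f t] : set RR).
Proof.
move=> mf; rewrite (_ : [set _ | _] = setT `&` f @^-1` `]x, +oo[%classic).
  by apply: mf => //; exact: measurable_itv.
by rewrite setTI; apply/seteqP; split => t /=; rewrite in_itv/= andbT.
Qed.

Lemma split_bit (B : set RR) : measurable B ->
  P B = (P [set t | bit t = true /\ B t] + P [set t | bit t = false /\ B t])%E.
Proof.
move=> mB; rewrite -measureU//.
- congr (P _); apply/seteqP; split => t /=; last by case=> -[].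
  by move=> Bt; case: (bit t); [left|right].
- by apply: measurableI => //; exact: measurable_bit_eq.
- by apply: measurableI => //; exact: measurable_bit_eq.
- by apply/seteqP; split => t //= -[[-> _] []].
Qed.

Lemma PF (B : set RR) : measurable B -> exists r, P B = r%:E.
Proof.
by move=> mB; exists (fine (P B)); rewrite fineK// fin_num_measure.
Qed.

Let s2 := shift \o shift.
Let T_ := dig id shift.
Let E_ := dig id s2.
Let O_ := dig shift s2.
Let mid : measurable_fun setT (id : RR -> RR). Proof. exact: measurable_id. Qed.
Let ms2 : measurable_fun setT (s2 : RR -> RR).
Proof. exact: (measurableT_comp measurable_shift measurable_shift). Qed.

Lemma T_step k x : P [set t | x < T_ k.+1 t] =
  (2^-1%:E * P [set t | (2 * x - 1 < T_ k t)%R]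
   + 2^-1%:E * P [set t | (2 * x < T_ k t)%R])%E.
Proof.
have mT k' x' : measurable ([set t | x' < T_ k' t] : set RR).
  by apply: mray; apply: measurable_dig => //; exact: measurable_shift.
rewrite split_bit// -(half true)// -(half false)//; congr (P _ + P _)%E.
- apply/seteqP; split => t /= [bt]; rewrite /T_/= bt/= => ?; split=> //; lra.
- apply/seteqP; split => t /= [bt]; rewrite /T_/= bt/= => ?; split=> //; lra.
Qed.

Lemma EO_step k x y :
  let F a b := P [set t | a < E_ k t /\ b < O_ k t] in
  P [set t | x < E_ k.+1 t /\ y < O_ k.+1 t] =
  (2^-1%:E * (2^-1%:E * F (2 * x - 1)%R (2 * y - 1)%R)
 + 2^-1%:E * (2^-1%:E * F (2 * x - 1)%R (2 * y)%R)
 + (2^-1%:E * (2^-1%:E * F (2 * x)%R (2 * y - 1)%R)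
 + 2^-1%:E * (2^-1%:E * F (2 * x)%R (2 * y)%R)))%E.
Proof.
move=> F.
have mF k' a b : measurable ([set t | a < E_ k' t /\ b < O_ k' t] : set RR).
  by apply: measurableI; apply: mray; apply: measurable_dig => //;
    exact: measurable_shift.
have ms (B : set RR) : measurable B -> measurable [set t | B (shift t)].
  by move=> mB; rewrite -[X in measurable X]setTI; exact: measurable_shift.
have mu u (B : set RR) : measurable B -> measurable [set t | bit t = u /\ B t].
  by move=> mB; apply: measurableI => //; exact: measurable_bit_eq.
have Q u v a b : (2^-1%:E * (2^-1%:E * F a b))%E =
   P [set t | bit t = u /\ (bit (shift t) = v /\ (a < E_ k (s2 t) /\ b < O_ k (s2 t)))].
  rewrite /F -(half v (mF k a b)) -(half u) //.
  exact: (mu v _ (ms _ (mF k a b))).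
rewrite (Q true true) (Q true false) (Q false true) (Q false false).
rewrite split_bit//.
have mC u : measurable ([set t | bit t = u /\ (x < E_ k.+1 t /\ y < O_ k.+1 t)] : set RR).
  by apply: mu; exact: mF.
have Sp u : P [set t | bit t = u /\ (x < E_ k.+1 t /\ y < O_ k.+1 t)] =
   (P [set t | bit (shift t) = true /\ (bit t = u /\ ((x < E_ k.+1 t)%R /\ (y < O_ k.+1 t)%R))]
  + P [set t | bit (shift t) = false /\ (bit t = u /\ ((x < E_ k.+1 t)%R /\ (y < O_ k.+1 t)%R))])%E.
  have mbs v : measurable ([set t | bit (shift t) = v] : set RR).
    exact: (ms _ (measurable_bit_eq v)).
  rewrite -measureU//.
  - congr (P _); apply/seteqP; split => t /=; last by case=> -[].
    by move=> Bt; case: (bit (shift t)); [left|right].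
  - exact: (measurableI _ _ (mbs true) (mC u)).
  - exact: (measurableI _ _ (mbs false) (mC u)).
  - by apply/seteqP; split => t //= -[[-> _] []].
rewrite !Sp; congr (P _ + P _ + (P _ + P _))%E;
  apply/seteqP; split => t /=; rewrite /E_ /O_/=.
all: try by move=> [b2 [b1]]; rewrite b1 b2 /= => -[? ?]; do !split => //; lra.
all: by move=> [b1 [b2]]; rewrite b1 b2 /= => -[? ?]; do !split => //; lra.
Qed.

Lemma EO_T k x y : P [set t | x < E_ k t /\ y < O_ k t] =
  (P [set t | (x < T_ k t)%R] * P [set t | (y < T_ k t)%R])%E.
Proof.
elim: k x y => [|k IH] x y.
  rewrite /E_ /O_ /T_/=.
  have PT : P [set t : RR | true] = 1%E.
    by rewrite (_ : [set _ | _] = setT) ?probability_setT//; apply/seteqP.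
  have P0 : P [set t : RR | false] = 0%E.
    by rewrite (_ : [set _ | _] = set0) ?measure0//; apply/seteqP; split.
  have PE (B C : set RR) : (forall t, B t <-> C t) -> P B = P C.
    by move=> BC; congr (P _); apply/seteqP; split=> t /BC.
  case: (x < 0); case: (y < 0); rewrite ?PT ?P0 ?mule0 ?mul0e ?mule1.
  - by rewrite -PT; apply: PE.
  - by apply: etrans P0; apply: PE => t; split=> // -[].
  - by apply: etrans P0; apply: PE => t; split=> // -[].
  - by apply: etrans P0; apply: PE => t; split=> // -[].
rewrite EO_step !T_step !IH.
have mT x' : measurable ([set t | x' < T_ k t] : set RR).
  by apply: mray; apply: measurable_dig => //; exact: measurable_shift.
have [r1 ->] := PF (mT (2 * x - 1)).
have [r2 ->] := PF (mT (2 * x)).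
have [r3 ->] := PF (mT (2 * y - 1)).
have [r4 ->] := PF (mT (2 * y)).
by rewrite -!EFinM -!EFinD; congr _%:E; ring.
Qed.

Let Et := dlim id s2.
Let Ot := dlim shift s2.
Let Tt := dlim id shift.
Let mE : measurable_fun setT (Et : RR -> RR). Proof. exact: measurable_dlim. Qed.
Let mO : measurable_fun setT (Ot : RR -> RR).
Proof. by apply: measurable_dlim => //; exact: measurable_shift. Qed.

Lemma EO_lim x y : P [set t | x < Et t /\ y < Ot t] =
  (P [set t | (x < Tt t)%R] * P [set t | (y < Tt t)%R])%E.
Proof.
have mT k x' : measurable ([set t | x' < T_ k t] : set RR).
  by apply: mray; apply: measurable_dig => //; exact: measurable_shift.
have mTt x' : measurable ([set t | x' < Tt t] : set RR).
  by apply: mray; apply: measurable_dlim => //; exact: measurable_shift.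
have cT x' : (P [set t | (x' < T_ k t)%R] @[k --> \oo] --> P [set t | (x' < Tt t)%R])%E.
  have TU : [set t | x' < Tt t] = \bigcup_k [set t | x' < T_ k t].
    apply/seteqP; split=> t /=; first by move=> /dlimP[k ?]; exists k.
    by move=> [k _ ?]; apply/dlimP; exists k.
  rewrite TU.
  apply: (@nondecreasing_cvg_mu _ RR R P (fun k => [set t | x' < T_ k t])) => //.
    by rewrite -TU.
  move=> i j ij; apply/subsetPset => t /= /lt_le_trans; apply.
  exact: dig_nd.
have cE : (P [set t | (x < E_ k t)%R /\ (y < O_ k t)%R] @[k --> \oo]
     --> P [set t | (x < Et t)%R /\ (y < Ot t)%R])%E.
  have TU : [set t | x < Et t /\ y < Ot t] = \bigcup_k [set t | x < E_ k t /\ y < O_ k t].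
    apply/seteqP; split=> t /=.
      move=> [/dlimP[k xk] /dlimP[l yl]]; exists (maxn k l) => //=; split.
        by apply: lt_le_trans xk _; apply: dig_nd; exact: leq_maxl.
      by apply: lt_le_trans yl _; apply: dig_nd; exact: leq_maxr.
    by move=> [k _ [? ?]]; split; apply/dlimP; exists k.
  rewrite TU.
  apply: (@nondecreasing_cvg_mu _ RR R P (fun k => [set t | x < E_ k t /\ y < O_ k t])) => //.
  - move=> k; apply: measurableI; apply: mray; apply: measurable_dig => //;
    exact: measurable_shift.
  - by rewrite -TU; apply: measurableI; apply: mray.
  - move=> i j ij; apply/subsetPset => t /= -[/lt_le_trans h1 /lt_le_trans h2].
    by split; [apply: h1|apply: h2]; exact: dig_nd.
apply: (cvg_unique _ cE) => //.
rewrite (_ : (fun k => _) = (fun k => (P [set t | (x < T_ k t)%R] *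
  P [set t | (y < T_ k t)%R])%E)); last by apply/funext => k; rewrite EO_T.
apply: cvgeM; [|exact: cT|exact: cT].
by apply: mule_def_fin; apply: fin_num_measure.
Qed.

Lemma dig_id k t : 0 <= t <= 1 -> t - 2^-1 ^+ k <= T_ k t <= t.
Proof.
elim: k t => [|k IH] t t01; first by rewrite expr0 /T_/=; lra.
have s01 : 0 <= shift t <= 1.
  by rewrite /shift /bit; case: (ltP t 2^-1) => ? /=; lra.
have TE : T_ k.+1 t = (bit t)%:R / 2 + T_ k (shift t) / 2 by [].
have := IH _ s01; rewrite TE exprS.
move: (T_ k (shift t)) => d; rewrite /shift.
move: ((2^-1 : R) ^+ k) ((bit t)%:R : R) => e b; lra.
Qed.

Lemma PT x : P [set t | x < Tt t] = P `]x, +oo[%classic.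
Proof.
have mTt x' : measurable ([set t | x' < Tt t] : set RR).
  by apply: mray; apply: measurable_dlim => //; exact: measurable_shift.
rewrite (P_E (mTt x)) P_E //.
congr (lebesgue_measure _); apply/seteqP; split=> t /=; rewrite !in_itv/= andbT.
  move=> [/dlimP[k xk] t01]; split=> //.
  by have /andP[_] := dig_id k t01; exact: lt_le_trans.
move=> [xt t01]; split=> //; apply/dlimP.
have : (2^-1 ^+ k @[k --> \oo] --> (0 : R)) by apply: cvg_expr; rewrite ger0_norm; lra.
move=> /cvgrPdist_lt/(_ (t - x)); rewrite subr_gt0 => /(_ xt) [k _ /(_ k (leqnn k))] /=.
rewrite sub0r normrN ger0_norm ?exprn_ge0// => h.
by exists k; have /andP[lb _] := dig_id k t01; apply: lt_le_trans lb; rewrite ltrBrDl -ltrBrDr.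
Qed.

Lemma EO_prod (A B : set RR) : measurable A -> measurable B ->
  P [set t | A (Et t) /\ B (Ot t)] = (P A * P B)%E.
Proof.
have mE' (C : set RR) : measurable C -> measurable ([set t | C (Et t)] : set RR).
  by move=> mC; rewrite -[X in measurable X]setTI; exact: mE.
have mO' (C : set RR) : measurable C -> measurable ([set t | C (Ot t)] : set RR).
  by move=> mC; rewrite -[X in measurable X]setTI; exact: mO.
have rayE x : (`]x, +oo[%classic : set R) = [set t | x < t].
  by apply/seteqP; split => t /=; rewrite in_itv/= andbT.
have mr x : measurable (`]x, +oo[%classic : set RR) by exact: measurable_itv.
have P1 (C : set RR) : measurable C -> (P C < +oo)%E.
  by move=> mC; apply: le_lt_trans (probability_le1 _ mC) (ltry 1).
have P0 (C : set RR) : 0 <= fine (P C) by rewrite fine_ge0.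
have S1 y (C : set RR) : measurable C ->
    P [set t | C (Et t) /\ y < Ot t] = (P C * P `]y, +oo[%classic)%E.
  move=> mC.
  have mD : measurable ([set t | y < Ot t] : set RR) by exact: mray.
  have [m1 m1E] := pushm (mrestr P mD) mE.
  pose m2 : {measure set RR -> \bar R} := mscale (NngNum (P0 `]y, +oo[%classic)) P.
  have e2 D : m2 D = (P D * P `]y, +oo[%classic)%E.
    rewrite muleC (_ : m2 D = ((fine (P `]y, +oo[%classic))%:E * P D)%E)//.
    by rewrite fineK// fin_num_measure.
  have e1 D : m1 D = P [set t | D (Et t) /\ y < Ot t] by rewrite m1E.
  rewrite -e1 -e2; apply: (@ray_unique m1 m2) => // x.
    rewrite e1 e2 -!PT -EO_lim; congr (P _); apply/seteqP.
    by split=> t /=; rewrite in_itv/= andbT.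
  by rewrite e1; apply: P1; apply: measurableI => //; apply: mE'.
move=> mA mB.
have mD : measurable ([set t | A (Et t)] : set RR) by exact: mE'.
have [m1 m1E] := pushm (mrestr P mD) mO.
pose m2 : {measure set RR -> \bar R} := mscale (NngNum (P0 A)) P.
have e2 D : m2 D = (P A * P D)%E.
  rewrite (_ : m2 D = ((fine (P A))%:E * P D)%E)//.
  by rewrite fineK// fin_num_measure.
have e1 D : m1 D = P [set t | A (Et t) /\ D (Ot t)].
  by rewrite m1E /mrestr; congr (P _); apply/seteqP; split=> t [].
rewrite -e1 -e2; apply: (@ray_unique m1 m2) => // x.
  by rewrite e1 e2 -S1//; congr (P _); apply/seteqP; split=> t /=; rewrite in_itv/= andbT.
by rewrite e1; apply: P1; apply: measurableI => //; apply: mO'.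
Qed.

Definition unif_seq (n : nat) (t : R) : R := Et (iter n Ot t).

Lemma measurable_unif_seq n : measurable_fun setT (unif_seq n : RR -> RR).
Proof.
rewrite /unif_seq; apply: (measurableT_comp mE).
elim: n => [|n IH] /=; first exact: mid.
exact: (measurableT_comp mO IH).
Qed.

Lemma unif_seqP N (A : nat -> set RR) : (forall n, measurable (A n)) ->
  P [set t | forall n, (n < N)%N -> A n (unif_seq n t)] =
  (\prod_(n < N) P (A n))%E.
Proof.
elim: N A => [|N IH] A mA.
  rewrite big_ord0 -(probability_setT P); congr (P _).
  by apply/seteqP; split.
rewrite big_ord_recl/= -(IH (A \o S))//= -EO_prod//; last first.
  rewrite (_ : [set _ | _] = \bigcap_(n in `I_N) [set t | A n.+1 (unif_seq n t)])//.
  apply: bigcap_measurableType => n _.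
  by rewrite -[X in measurable X]setTI; exact: measurable_unif_seq.
congr (P _); apply/seteqP; split => t /=.
  move=> h; split; first exact: (h 0%N).
  by move=> n nN; have := h n.+1 nN; rewrite /unif_seq iterSr.
by move=> [h0 h] [//|n nN]; have := h n nN; rewrite /unif_seq iterSr.
Qed.

End uniform_sequence.

End UniformSequence.

(* Generators of the product sigma-algebra on I -> R. *)
Definition cylinders (I : Type) (R : realType) : set (set (I -> R)) :=
  [set B | exists i (A : set (measurableTypeR R)),
    measurable A /\ B = [set t | A (t i)]].

Notation cube I R := (g_sigma_algebraType (@cylinders I R)).

Lemma cube_measure_exists (I : countType) (R : realType) :
  exists mu : probability (cube I R) R,
    forall (J : {fset I}) (A : I -> set (measurableTypeR R)),
      (forall i, measurable (A i)) ->
      mu [set t | forall i, i \in J -> A i (t i)] =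
      (\prod_(i <- J) uniform_prob (@ltr01 R) (A i))%E.
Proof.
pose P : probability (measurableTypeR R) R := uniform_prob (@ltr01 R).
pose Z (t : measurableTypeR R) : cube I R := fun i => UniformSequence.unif_seq (choice.pickle i) t.
have mZ : measurable_fun setT Z.
  apply: (@measurability _ _ _ _ _ Z (@cylinders I R)) => //.
  move=> _ [_ [i [A [mA ->]]] <-].
  exact: (@UniformSequence.measurable_unif_seq R (choice.pickle i) measurableT A mA).
pose Z' : {mfun measurableTypeR R >-> cube I R} := mfun_Sub (mem_set mZ).
exists (distribution P Z') => J A mA.
pose A' n := if choice.pickle_inv n is Some i then if i \in J then A i else setT
             else setT : set (measurableTypeR R).
have mA' n : measurable (A' n).
  by rewrite /A'; case: pickle_inv => // i; case: ifP.
pose N := (\sum_(i <- J) (choice.pickle i).+1)%N.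
have JN i : i \in J -> (choice.pickle i < N)%N.
  by move=> iJ; rewrite /N (big_rem i)//= addSn ltnS leq_addr.
rewrite /distribution /pushforward.
transitivity (P [set t | forall n, (n < N)%N -> A' n (UniformSequence.unif_seq n t)]).
  congr (P _); apply/seteqP; split => t /=.
    move=> h n nN; rewrite /A'; case E : (choice.pickle_inv n) => [i|//].
    case: ifP => // /h; have := @pickle_invK I n; rewrite E /= => <-.
    exact.
  move=> h i iJ; have := h _ (JN _ iJ).
  by rewrite /A' pickleK_inv iJ.
rewrite UniformSequence.unif_seqP// -/P.
rewrite -(big_mkord xpredT (fun n => P (A' n))) /index_iota subn0.
rewrite (bigID (mem (map choice.pickle J)))/= [X in (_ * X)%E]big1 ?mule1; last first.
  move=> n nJ; rewrite /A'; case E : (choice.pickle_inv n) => [i|]; last first.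
    exact: probability_setT.
  case: ifP => iJ; last exact: probability_setT.
  have := @pickle_invK I n; rewrite E /= => nE.
  by move: nJ; rewrite -nE map_f.
rewrite -big_filter (perm_big (map choice.pickle J)); last first.
  apply: uniq_perm.
  - by rewrite filter_uniq// iota_uniq.
  - by rewrite map_inj_uniq ?fset_uniq//; exact: pcan_inj (@pickleK_inv I).
  - move=> n; rewrite mem_filter mem_iota/= add0n.
    case: (boolP (n \in _)) => //= /mapP[i iJ ->]; exact: JN.
rewrite big_map; apply: eq_big_seq => i iJ.
by rewrite /A' pickleK_inv iJ.
Qed.

(* The product over I of the uniform probability measure on [0, 1]; it is
   determined by cube_measureE. *)
Definition cube_measure (I : countType) (R : realType) :
    probability (cube I R) R :=
  projT1 (cid (cube_measure_exists I R)).

Lemma cube_measureE (I : countType) (R : realType) (J : {fset I})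
    (A : I -> set (measurableTypeR R)) :
  (forall i, measurable (A i)) ->
  cube_measure I R [set t | forall i, i \in J -> A i (t i)] =
  (\prod_(i <- J) uniform_prob (@ltr01 R) (A i))%E.
Proof. exact: (projT2 (cid (cube_measure_exists I R))). Qed.

Definition circle_pt (R : realType) (t : R) : R[i] :=
  (cos (2 * pi * t) +i* sin (2 * pi * t))%C.

(* \int_{T^I} f(z) dz: normalized Lebesgue measure on the circle T is the image
   of the uniform measure on [0, 1] under circle_pt. I = 'I_N gives T^N and
   I = nat gives T^infinity. *)
Definition torus_int (I : countType) (R : realType) (f : (I -> R[i]) -> R) :
    \bar R :=
  (\int[cube_measure I R]_t (f (fun i => circle_pt (t i)))%:E)%E.

(* In a normed R[i]-module the norm takes its values in R[i]. *)
Definition rnorm (R : realType) (X : normedModType R[i]) (x : X) : R :=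
  complex.Re `|x|.

Lemma rnormE (R : realType) (X : normedModType R[i]) (x : X) :
  `|x| = (rnorm x)%:C%C.
Proof. by rewrite /rnorm RRe_real// normr_real. Qed.

Section definitions.
Context (R : realType).
Implicit Types (X U : completeNormedModType R[i]) (q : R).

Definition cotype X q : Prop :=
  exists2 C : R, 0 < C & forall (N : nat) (x : 'I_N -> X),
    (((\sum_(k < N) rnorm (x k) `^ q) `^ q^-1)%:E <=
     C%:E * torus_int (fun z : 'I_N -> R[i] =>
              (rnorm (\sum_(k < N) z k *: x k) ^+ 2)%R) `^ (2^-1)%R)%E.

Definition multi_index := {fsfun nat -> nat with 0%N}.

Definition mi_deg (a : multi_index) : nat := (\sum_(i <- finsupp a) a i)%N.

Definition mi_monomial (z : nat -> R[i]) (a : multi_index) : R[i] :=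
  \prod_(i <- finsupp a) z i ^+ a i.

Definition hypercontractive_homogeneous_cotype X q : Prop :=
  exists2 C : R, 0 < C & forall m : nat, (0 < m)%N ->
    forall x : {fsfun multi_index -> X with 0},
    (forall a, a \in finsupp x -> mi_deg a = m) ->
    (((\sum_(a <- finsupp x) rnorm (x a) `^ q) `^ q^-1)%:E <=
     (C ^+ m)%:E * torus_int (fun z : nat -> R[i] =>
              (rnorm (\sum_(a <- finsupp x) mi_monomial z a *: x a) ^+ 2)%R)
                   `^ (2^-1)%R)%E.

Definition finite_dim_subspace X (F : set X) : Prop :=
  exists (n : nat) (e : 'I_n -> X),
    F = [set x | exists c : 'I_n -> R[i], x = \sum_(i < n) c i *: e i].

(* An operator F -> Y on a subspace F of X is represented by a function X -> Y
   whose values outside F are irrelevant. *)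
Definition linear_on X U (F : set X) (T : X -> U) : Prop :=
  forall (c : R[i]) (x y : X), F x -> F y -> T (c *: x + y) = c *: T x + T y.

Definition opnorm X U (F : set X) (T : X -> U) : \bar R :=
  ereal_sup [set (rnorm (T x))%:E | x in [set x | F x /\ rnorm x <= 1]].

Definition bounded_operator X U (F : set X) (T : X -> U) : Prop :=
  linear_on F T /\ (opnorm F T < +oo)%E.

Definition coefs_on (D : set nat) (a : nat -> R[i]) : Prop :=
  forall n, ~ D n -> a n = 0.

(* The basis is {u n | n in D}, ordered as in nat; a finite D accounts for
   finite-dimensional U. The values of u outside D are irrelevant. *)
Definition schauder_basis U (D : set nat) (u : nat -> U) : Prop :=
  forall x : U, exists! a : nat -> R[i],
    coefs_on D a /\ series (fun n => a n *: u n) @ \oo --> x.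

Definition unconditional_basis U (D : set nat) (u : nat -> U) : Prop :=
  schauder_basis D u /\
  forall (x : U) (a : nat -> R[i]), coefs_on D a ->
    series (fun n => a n *: u n) @ \oo --> x ->
    forall s : nat -> nat, bijective s ->
      series (fun n => a (s n) *: u (s n)) @ \oo --> x.

Definition unconditional_constant U (D : set nat) (u : nat -> U) : \bar R :=
  ereal_inf [set c%:E | c in [set c : R | 0 <= c /\
    forall (N : nat) (a eps : nat -> R[i]),
      coefs_on D a -> (forall n, `|eps n| = 1) ->
      rnorm (\sum_(n < N) eps n *: (a n *: u n)) <=
      c * rnorm (\sum_(n < N) a n *: u n)]].

Definition local_unconditional_structure X : Prop :=
  exists2 lam : R, 0 < lam &
    forall F : set X, finite_dim_subspace F ->
    exists (U : completeNormedModType R[i]) (D : set nat) (u : nat -> U)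
           (T : X -> U) (S : U -> X),
      [/\ unconditional_basis D u,
          bounded_operator F T,
          bounded_operator setT S,
          forall x, F x -> S (T x) = x &
          (opnorm F T * opnorm setT S * unconditional_constant D u
             <= lam%:E)%E].

End definitions.

(* Main.v *)
Require Import Defs.
From mathcomp Require Import all_boot all_order all_algebra.
From mathcomp Require Import all_classical all_reals all_analysis.
From mathcomp Require Import complex.
From mathcomp Require Import finmap measurable_realfun lra ring.
Local Open Scope ring_scope.

Set Implicit Arguments.
Unset Strict Implicit.
Unset Printing Implicit Defensive.

Import Order.TTheory GRing.Theory Num.Theory numFieldNormedType.Exports.
Import ComplexField.Normc.
Local Open Scope classical_set_scope.

(* By cotype, an operator V from C(K) to X (K finite) of norm B satisfies
   sum |V b_j|^q <= (C B)^q whenever sum |b_j| <= 1. A sampling argument improves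
   this to sum p_j |V b_j|^q <= K B^q for weights p_j, |b_j| <= 1 and
   sum p_j |b_j| <= 1. Applied to the level sets of the subgaussian functions
   sum_j +- g_j, it gives sum |V g_j|^q <= K B^q as soon as sum |g_j|^2 <= 1.

   Given the polynomial P = sum x_a z^a, factor the span of the x_a through U and
   let s be the square function of the coordinates p_k of the U-valued polynomial.
   With V b = S (sum_k b_k s_k u_k) the previous bound reads
   sum |x_a|^q <= K |sum_k s_k u_k|^q. The L^4 norm of an m-homogeneous p_k is at
   most sqrt 2 ^ m times its L^2 norm (a multi-index of degree 2m is a sum of two
   in at most 4^m ways), so s_k <= 6^m E|p_k|, and by unconditionality the norm of
   sum_k s_k u_k is at most a constant times 6^m E|P|. All expectations are over
   finite products of groups of roots of unity and are compared with the torus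
   integral by rotation invariance. *)

(** * The modulus on R[i] and the real-valued norm *)

(** All constants must be independent of the number of coordinates, since the basis of U is
    truncated at an arbitrary length, and they may grow at most exponentially in m. The degree
    enters through a single scalar inequality, L^2 against L^1 for homogeneous polynomials, applied
    to one coordinate at a time. It ends in an L^1 norm so that the vector-valued step, pulling the
    mean out of the norm of U, is the triangle inequality.

    Cotype is used twice: for the summing bound on V, and to replace sum |V g_j|^q by a mean over
    signs of |V (sum_j +- g_j)|^q. The summing bound alone cannot control such a mean: rescaling it
    to the average of N functions costs a factor N^(q-1). The weighted form removes this loss for
    functions cut at a fixed height, and the fast decay of the tails of sign sums allows the heights
    to be summed. *)

Section modulus.
Context {R : realType}.
Implicit Types (z w : R[i]) (X : normedModType R[i]).

Lemma normcEC z : `|z| = (normc z)%:C%C.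
Proof. by case: z. Qed.

Lemma normc_ge0 z : 0 <= normc z.
Proof. by case: z => a b; exact: sqrtr_ge0. Qed.

Lemma sqr_normcE z : normc z ^+ 2 = complex.Re z ^+ 2 + complex.Im z ^+ 2.
Proof. by case: z => a b; rewrite /normc sqr_sqrtr// addr_ge0// sqr_ge0. Qed.

Lemma normc_real (a : R) : normc a%:C%C = `|a|.
Proof. by rewrite /normc/= expr0n/= addr0 sqrtr_sqr. Qed.

Lemma normcX z n : normc (z ^+ n) = normc z ^+ n.
Proof. by elim: n => [|n IH]; rewrite ?expr0 ?normc1// !exprS normcM IH. Qed.

Lemma normc_sign (b : bool) : normc ((-1) ^+ b : R[i]) = 1.
Proof. by apply: complexI; rewrite -normcEC normrX normrN normr1 expr1n. Qed.

Lemma normc_prod (I : Type) (r : seq I) (F : I -> R[i]) :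
  normc (\prod_(i <- r) F i) = \prod_(i <- r) normc (F i).
Proof.
by elim/big_rec2: _ => [|i x y _ <-]; rewrite ?normc1// normcM.
Qed.

Lemma normcD z w : normc (z + w) <= normc z + normc w.
Proof. by have := ler_normD z w; rewrite !normcEC -rmorphD/= lecR. Qed.

Lemma normc_sum (I : Type) (r : seq I) (F : I -> R[i]) :
  normc (\sum_(i <- r) F i) <= \sum_(i <- r) normc (F i).
Proof.
elim/big_rec2: _ => [|i x y _ h]; first by rewrite normc0.
by apply: le_trans (normcD _ _) _; rewrite lerD2l.
Qed.

Lemma Re_le_normc z : `|complex.Re z| <= normc z.
Proof. by have := normc_ge_Re z; rewrite normcEC lecR. Qed.

Lemma Im_le_normc z : `|complex.Im z| <= normc z.
Proof.
by have := Re_le_normc ('i%C * z); rewrite mulrC ReiNIm normrN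
  normcM /= !expr0n expr1n add0r sqrtr1 mulr1.
Qed.

Lemma normc_le_ReIm z : normc z <= `|complex.Re z| + `|complex.Im z|.
Proof.
rewrite -ler_sqr ?nnegrE ?addr_ge0 ?normc_ge0// sqr_normcE sqrrD !real_normK ?num_real//.
have := mulr_ge0 (normr_ge0 (complex.Re z)) (normr_ge0 (complex.Im z)); lra.
Qed.

Lemma rnorm_ge0 X (x : X) : 0 <= rnorm x.
Proof. by have := normr_ge0 x; rewrite rnormE lecR. Qed.

Lemma rnormD X (x y : X) : rnorm (x + y) <= rnorm x + rnorm y.
Proof. by have := ler_normD x y; rewrite !rnormE -rmorphD/= lecR. Qed.

Lemma rnormZ X z (x : X) : rnorm (z *: x) = normc z * rnorm x.
Proof.
have := normrZ z x; rewrite !rnormE normcEC -rmorphM/=.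
exact: complexI.
Qed.

Lemma rnorm0 X : rnorm (0 : X) = 0.
Proof. by rewrite /rnorm normr0. Qed.

Lemma rnormN X (x : X) : rnorm (- x) = rnorm x.
Proof. by rewrite /rnorm normrN. Qed.

Lemma rnormB X (x y : X) : `|rnorm x - rnorm y| <= rnorm (x - y).
Proof.
have h (a b : X) : rnorm a - rnorm b <= rnorm (a - b).
  by have := rnormD (a - b) b; rewrite subrK; lra.
have := h x y; have := h y x; rewrite -(rnormN (y - x)) opprB => h1 h2.
by rewrite ler_norml; lra.
Qed.

Lemma rnorm_eq0 X (x : X) : rnorm x = 0 -> x = 0.
Proof. by move=> x0; apply/normr0_eq0; rewrite rnormE x0. Qed.

Lemma rnorm_sum X (I : Type) (r : seq I) (P : pred I) (F : I -> X) :
  rnorm (\sum_(i <- r | P i) F i) <= \sum_(i <- r | P i) rnorm (F i).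
Proof.
elim/big_rec2: _ => [|i x y _ h]; first by rewrite rnorm0.
by apply: le_trans (rnormD _ _) _; rewrite lerD2l.
Qed.

Lemma powRD_le (q x y : R) : 0 <= q -> 0 <= x -> 0 <= y ->
  (x + y) `^ q <= 2 `^ q * (x `^ q + y `^ q).
Proof.
move=> q0 x0 y0; wlog xy : x y x0 y0 / x <= y.
  move=> H; have [/H->//|/ltW yx] := leP x y.
  by rewrite addrC [X in _ * X]addrC; apply: H.
apply: (@le_trans _ _ ((2 * y) `^ q)).
  by apply: ge0_ler_powR; rewrite ?nnegrE; lra.
by rewrite powRM// ler_wpM2l ?powR_ge0// lerDr powR_ge0.
Qed.

End modulus.

(** * Random sampling and Rademacher sums *)

Section sampling.
Context {R : realType} {J : finType} (N : nat) (w : J -> R).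
Hypothesis w0 : forall j, 0 <= w j.
Hypothesis w1 : \sum_j w j = 1.
Let pr (s : {ffun 'I_N -> J}) := \prod_i w (s i).

Lemma sample_prod (H : 'I_N -> J -> R) :
  \sum_s pr s * \prod_i H i (s i) = \prod_i \sum_j w j * H i j.
Proof.
rewrite bigA_distr_bigA/=; apply: eq_bigr => s _.
by rewrite /pr -big_split.
Qed.

Lemma sample1 (i : 'I_N) (F : J -> R) :
  \sum_s pr s * F (s i) = \sum_j w j * F j.
Proof.
have := sample_prod (fun l j => if l == i then F j else 1).
rewrite [RHS](bigD1 i)//= eqxx [X in _ * X]big1 ?mulr1 => [<-|l /negbTE li].
  apply: eq_bigr => s _; congr (_ * _).
  by rewrite (bigD1 i)//= eqxx big1 ?mulr1// => l /negbTE ->.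
by rewrite li -[RHS]w1; apply: eq_bigr => j _; rewrite mulr1.
Qed.

Lemma sample_total : \sum_s pr s = 1.
Proof.
transitivity (\sum_s pr s * \prod_(i < N) (1 : R)).
  by apply: eq_bigr => s _; rewrite big1// mulr1.
rewrite (sample_prod (fun _ _ => 1)) big1// => i _.
by under eq_bigr do rewrite mulr1.
Qed.

Lemma sample2 (i i' : 'I_N) (F : J -> R) : i' != i ->
  \sum_s pr s * (F (s i) * F (s i')) = (\sum_j w j * F j) ^+ 2.
Proof.
move=> ii'; rewrite [RHS]expr2.
have := sample_prod (fun l j => if (l == i) || (l == i') then F j else 1).
rewrite [RHS](bigD1 i)//= eqxx/= (bigD1 i')//= eqxx orbT.
rewrite [X in _ * (_ * X)]big1 ?mulr1 => [<-|l /andP[/negbTE-> /negbTE->]/=].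
  apply: eq_bigr => s _; congr (_ * _).
  rewrite (bigD1 i)//= eqxx/= (bigD1 i')//= eqxx orbT big1 ?mulr1//.
  by move=> l /andP[/negbTE-> /negbTE->].
by rewrite -[RHS]w1; apply: eq_bigr => j _; rewrite mulr1.
Qed.

(** With mu the mean of F, the diagonal terms contribute at most N mu because F^2 <= F, and by
    independence the others at most (N mu)^2. *)
Lemma sample_second_moment (F : J -> R) : (forall j, 0 <= F j <= 1) ->
  N%:R * \sum_j w j * F j <= 1 ->
  \sum_s pr s * (\sum_i F (s i)) ^+ 2 <= 2.
Proof.
move=> F01; set mu := \sum_j w j * F j => Nmu.
have mu0 : 0 <= mu.
  by apply: sumr_ge0 => j _; apply: mulr_ge0 => //; have /andP[] := F01 j.
have E i i' : \sum_s pr s * (F (s i) * F (s i')) <= (if i' == i then mu else mu ^+ 2).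
  case: eqVneq => [->|ii']; last by rewrite sample2.
  rewrite (sample1 i (fun j => F j * F j)).
  by apply: ler_sum => j _; have /andP[? ?] := F01 j;
    apply: ler_wpM2l => //; apply: ler_piMr.
apply: (@le_trans _ _ (\sum_(i < N) \sum_(i' < N) \sum_s pr s * (F (s i) * F (s i')))).
  rewrite le_eqVlt; apply/orP; left; apply/eqP.
  transitivity (\sum_s \sum_(i < N) \sum_(i' < N) pr s * (F (s i) * F (s i'))).
    apply: eq_bigr => s _; rewrite expr2 big_distrlr/= mulr_sumr.
    by apply: eq_bigr => i _; rewrite mulr_sumr.
  by rewrite exchange_big/=; apply: eq_bigr => i _; rewrite exchange_big.
apply: (@le_trans _ _ (\sum_(i < N) (mu + N%:R * mu ^+ 2))).
  apply: ler_sum => i _; apply: le_trans (ler_sum _ (fun i' _ => E i i')) _.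
  rewrite (bigD1 i)//= eqxx lerD2l.
  apply: (@le_trans _ _ (\sum_(i' < N) mu ^+ 2)); last first.
    by rewrite sumr_const card_ord -[mu ^+ 2 *+ _]mulr_natl.
  rewrite [leRHS](bigD1 i)//= -[leLHS]add0r; apply: lerD; first exact: sqr_ge0.
  by apply: ler_sum => i' /negbTE ->.
rewrite sumr_const card_ord -[_ *+ N]mulr_natl mulrDr mulrA -expr2 -exprMn.
have Nmu0 : 0 <= N%:R * mu by apply: mulr_ge0.
have := exprn_ile1 2 Nmu0 Nmu; lra.
Qed.

End sampling.

Section rademacher.
Context {R : realType}.

(** From 1 - s/2 <= exp (- s/2) comes exp s <= (1 - s/2)^-2; adding the cases s = t and s = -t
    leaves a rational inequality in t^2. The exponent is larger than the optimal t^2 / 2, but only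
    subgaussian decay matters. *)
Lemma expR_add_le (t : R) : `|t| <= 1 -> expR t + expR (- t) <= 2 * expR (2 * t ^+ 2).
Proof.
move=> t1; have [t1a t1b] : - 1 <= t /\ t <= 1 by move: t1; rewrite ler_norml => /andP.
have H (s : R) : -1 <= s -> s <= 1 -> expR s <= ((1 - s / 2) ^+ 2)^-1.
  move=> s1 s2; have h : 1 - s / 2 <= expR (- (s / 2)) by apply: le_trans (expR_ge1Dx _); lra.
  rewrite -[s in leLHS]opprK expRN lef_pV2 ?posrE ?expR_gt0 ?exprn_gt0; [|lra..].
  rewrite [s in leRHS](_ : s = s / 2 + s / 2); last by lra.
  rewrite opprD expRD -expr2 ler_sqr// ?nnegrE ?expR_ge0//; lra.
have h1 := H _ t1a t1b.
have h2 : expR (- t) <= ((1 + t / 2) ^+ 2)^-1.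
  by have := H (- t); rewrite mulNr opprK; apply; lra.
have h3 : 1 + 2 * t ^+ 2 <= expR (2 * t ^+ 2) by exact: expR_ge1Dx.
apply: le_trans (lerD h1 h2) _.
apply: (@le_trans _ _ (2 * (1 + 2 * t ^+ 2))); last by rewrite ler_pM2l.
have t2 : t ^+ 2 <= 1 by rewrite -(expr1n R 2) -real_normK ?num_real// ler_sqr ?nnegrE.
have t20 := sqr_ge0 t.
have d : 0 < (1 - t / 2) ^+ 2 * (1 + t / 2) ^+ 2.
  by apply: mulr_gt0; apply: exprn_gt0; lra.
have -> : ((1 - t / 2) ^+ 2)^-1 + ((1 + t / 2) ^+ 2)^-1 =
   (2 * (1 + t ^+ 2 / 4)) / ((1 - t / 2) ^+ 2 * (1 + t / 2) ^+ 2).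
  by field; apply/andP; split; apply/eqP; lra.
rewrite ler_pdivrMr// -[leRHS]mulrA ler_pM2l//.
have -> : (1 - t / 2) ^+ 2 * (1 + t / 2) ^+ 2 = (1 - t ^+ 2 / 4) ^+ 2 by field.
move: (t ^+ 2) t2 t20 => x x1 x0.
have := mulr_ge0 x0 (mulr_ge0 x0 x0); have := mulr_ge0 x0 x0; nra.
Qed.

Context (I : finType).
Let D : finType := {ffun I -> bool}.

Lemma rademacher_exp (a : I -> R) : \sum_i a i ^+ 2 <= 1 ->
  \sum_(e : D) expR (\sum_i (-1) ^+ e i * a i) <= expR 2 * #|D|%:R.
Proof.
move=> a1; have ai i : `|a i| <= 1.
  rewrite -ler_sqr ?nnegrE// expr1n real_normK ?num_real//; apply: le_trans a1.
  by rewrite (bigD1 i)//= lerDl sumr_ge0// => j _; exact: sqr_ge0.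
under eq_bigr do rewrite expR_sum.
rewrite -(bigA_distr_bigA (fun i (b : bool) => expR ((-1) ^+ b * a i))).
apply: (@le_trans _ _ (\prod_(i : I) (2 * expR (2 * a i ^+ 2)))).
  apply: ler_prod => i _; rewrite big_bool/= expr1 expr0 mul1r mulN1r addr_ge0 ?expR_ge0//=.
  by rewrite addrC expR_add_le.
rewrite big_split/= -expR_sum prodr_const card_ffun card_bool natrX mulrC.
by rewrite ler_wpM2r ?exprn_ge0// ler_expR -mulr_sumr; lra.
Qed.

Lemma exprn_le_expR r (x : R) : 0 <= x -> x ^+ r <= r%:R ^+ r * expR x.
Proof.
move=> x0; case: r => [|r]; first by rewrite !expr0 mul1r (le_trans _ (expR_ge1Dx x))//; lra.
have r0 : 0 < r.+1%:R :> R by [].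
have -> : expR x = expR (x / r.+1%:R) ^+ r.+1.
  by rewrite -expRM_natl mulrC divfK// gt_eqF.
rewrite -exprMn lerXn2r ?nnegrE ?mulr_ge0 ?expR_ge0//.
by rewrite -ler_pdivrMl// [_^-1 * _]mulrC; apply: le_trans (expR_ge1Dx _); rewrite lerDr.
Qed.

Lemma rademacher_moment r (a : I -> R) : \sum_i a i ^+ 2 <= 1 ->
  \sum_(e : D) `|\sum_i (-1) ^+ e i * a i| ^+ r
    <= r%:R ^+ r * (2 * expR 2) * #|D|%:R.
Proof.
move=> a1; rewrite -mulrA.
apply: (@le_trans _ _ (\sum_(e : D) r%:R ^+ r * (expR (\sum_i (-1) ^+ e i * a i) +
   expR (\sum_i (-1) ^+ e i * - a i)))).
  apply: ler_sum => e _; apply: le_trans (exprn_le_expR _ _) _ => //.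
  apply: ler_wpM2l; first exact: exprn_ge0.
  under [X in _ + expR X]eq_bigr do rewrite mulrN.
  rewrite sumrN; have [_|_] := ger0P (\sum_i (-1) ^+ e i * a i).
    by rewrite lerDl expR_ge0.
  by rewrite lerDr expR_ge0.
rewrite -mulr_sumr ler_wpM2l ?exprn_ge0// big_split/=.
have := rademacher_exp a1; have : \sum_i (- a i) ^+ 2 <= 1.
  by under eq_bigr do rewrite sqrrN.
move=> /rademacher_exp; lra.
Qed.

(** The factor 2^r and the last factor 2 pay for splitting a complex sum into real and imaginary
    parts; r^r comes from x^r <= r^r exp x, and [2 * expR 2] bounds the mean of exp S + exp (- S)
    for a sign sum S. *)
Definition rademacher_const r : R := 2 ^+ r * (r%:R ^+ r * (2 * expR 2) * 2).

Lemma rademacher_moment_complex r (g : I -> R[i]) : \sum_i normc (g i) ^+ 2 <= 1 ->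
  \sum_(e : D) normc (\sum_i (-1) ^+ e i * g i) ^+ r <= rademacher_const r * #|D|%:R.
Proof.
move=> g1.
have ReS (e : D) : complex.Re (\sum_i (-1) ^+ e i * g i) = \sum_i (-1) ^+ e i * complex.Re (g i).
  rewrite raddf_sum; apply: eq_bigr => i _.
  by case: (e i); rewrite ?expr0 ?expr1 ?mul1r ?mulN1r ?raddfN.
have ImS (e : D) : complex.Im (\sum_i (-1) ^+ e i * g i) = \sum_i (-1) ^+ e i * complex.Im (g i).
  rewrite raddf_sum; apply: eq_bigr => i _.
  by case: (e i); rewrite ?expr0 ?expr1 ?mul1r ?mulN1r ?raddfN.
have Re1 : \sum_i complex.Re (g i) ^+ 2 <= 1.
  by apply: le_trans g1; apply: ler_sum => i _; rewrite sqr_normcE lerDl sqr_ge0.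
have Im1 : \sum_i complex.Im (g i) ^+ 2 <= 1.
  by apply: le_trans g1; apply: ler_sum => i _; rewrite sqr_normcE lerDr sqr_ge0.
apply: (@le_trans _ _ (\sum_(e : D) 2 ^+ r * (`|\sum_i (-1) ^+ e i * complex.Re (g i)| ^+ r
   + `|\sum_i (-1) ^+ e i * complex.Im (g i)| ^+ r))).
  apply: ler_sum => e _; rewrite -ReS -ImS.
  apply: (@le_trans _ _ ((`|complex.Re (\sum_i (-1) ^+ e i * g i)| +
      `|complex.Im (\sum_i (-1) ^+ e i * g i)|) ^+ r)).
    by rewrite lerXn2r ?nnegrE ?normc_ge0 ?addr_ge0// normc_le_ReIm.
  by rewrite -!powR_mulrn ?addr_ge0//; apply: powRD_le.
rewrite -mulr_sumr /rademacher_const -mulrA ler_wpM2l ?exprn_ge0// big_split/=.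
have := rademacher_moment r Re1; have := rademacher_moment r Im1; lra.
Qed.

End rademacher.

(** * Concavity of operators into a space of cotype q *)

Section cotype_concavity.
Context {R : realType} (X : normedModType R[i]) (q : R).

(** Cotype in the form in which it is applied, with q-th moments over signs. The twist [z] is there
    because averaging the torus integral over the group of signs leaves an arbitrary point of the
    torus in every term. *)
Definition sign_cotype (C : R) : Prop :=
  forall (I : finType) (x : I -> X) (A : R), 0 < A ->
  (forall z : I -> R[i], (forall i, normc (z i) = 1) ->
    \sum_(e : {ffun I -> bool}) rnorm (\sum_i ((-1) ^+ e i * z i) *: x i) `^ q
      <= A * #|{: {ffun I -> bool}}|%:R) ->
  \sum_i rnorm (x i) `^ q <= C * A.

Hypothesis q2 : 2 <= q.
Let q_gt0 : 0 < q. Proof. exact: lt_le_trans q2. Qed.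
Let q1 : 1 <= q. Proof. by apply: le_trans q2; rewrite ler1n. Qed.
Let q0 : 0 <= q. Proof. exact: ltW. Qed.

Lemma sign_cotype_sup (C : R) (I : finType) (x : I -> X) (M : R) :
  sign_cotype C -> 0 < M ->
  (forall z : I -> R[i], (forall i, normc (z i) = 1) ->
    rnorm (\sum_i z i *: x i) <= M) ->
  \sum_i rnorm (x i) `^ q <= C * M `^ q.
Proof.
move=> hC M0 hM; apply: hC => [|z z1]; first exact: powR_gt0.
rewrite mulr_natr -sumr_const; apply: ler_sum => e _.
apply: ge0_ler_powR; rewrite ?nnegrE ?rnorm_ge0//; first exact: ltW.
by apply: hM => i; rewrite normcM z1 mulr1 normc_sign.
Qed.

Context (K : finType) (v : K -> X) (B C : R).
Let V (b : K -> R[i]) : X := \sum_k b k *: v k.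
Hypothesis B0 : 0 < B.
Hypothesis C0 : 0 <= C.
Hypothesis hC : sign_cotype C.
Hypothesis hB : forall b, (forall k, normc (b k) <= 1) -> rnorm (V b) <= B.

Lemma rnorm_bound_scale (b : K -> R[i]) (L : R) : 0 <= L ->
  (forall k, normc (b k) <= L) -> rnorm (V b) <= L * B.
Proof.
rewrite le_eqVlt => /predU1P[<-|L0] bL.
  rewrite mul0r /V big1 ?rnorm0// => k _.
  have -> : b k = 0 by apply: eq0_normc; apply/eqP; rewrite eq_le bL normc_ge0.
  by rewrite scale0r.
have L0' : normc L%:C%C = L by rewrite normc_real gtr0_norm.
have Lu : L%:C%C != 0 :> R[i] by rewrite fmorph_eq0 gt_eqF.
have -> : V b = L%:C%C *: V (fun k => b k / L%:C%C).
  rewrite /V scaler_sumr; apply: eq_bigr => k _.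
  by rewrite scalerA mulrC divfK.
rewrite rnormZ L0' ler_pM2l//; apply: hB => k.
by rewrite normcM normcV L0' ler_pdivrMr// mul1r.
Qed.

(** The (q,1)-summing property of V: a combination of the V (b_i) with unimodular coefficients is V
    of a function bounded by the sum of the |b_i|. *)
Lemma disjoint_concave (I : finType) (b : I -> K -> R[i]) (L : R) : 0 < L ->
  (forall k, \sum_i normc (b i k) <= L) ->
  \sum_i rnorm (V (b i)) `^ q <= C * (L * B) `^ q.
Proof.
move=> L0 bL; apply: sign_cotype_sup => //; first exact: mulr_gt0.
move=> z z1.
have -> : \sum_i z i *: V (b i) = V (fun k => \sum_i z i * b i k).
  rewrite /V; under eq_bigr do rewrite scaler_sumr.
  rewrite exchange_big/=; apply: eq_bigr => k _.
  by rewrite scaler_suml; apply: eq_bigr => i _; rewrite scalerA.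
apply: rnorm_bound_scale => [|k]; first exact: ltW.
apply: le_trans (normc_sum _ _) _; apply: le_trans (bL k).
by apply: ler_sum => i _; rewrite normcM z1 mul1r.
Qed.

(** For p_j = 1 this is the (q,1)-summing property. For p_j = 1/N, rescaling that property would
    only give a bound of order N^(q-1), so a [Psi] valid for all weights is a real gain. *)
Definition concave_bound (Psi : R) : Prop :=
  forall (J : finType) (p : J -> R) (b : J -> K -> R[i]),
  (forall j, 0 <= p j) -> (forall j k, normc (b j k) <= 1) ->
  (forall k, \sum_j p j * normc (b j k) <= 1) ->
  \sum_j p j * rnorm (V (b j)) `^ q <= Psi.

(** A crude bound from |V b| <= B max |b| and max |b| <= sum_k |b k|. Its dependence on #|K| is
    harmless: it only supplies a finite value from which to iterate. *)
Lemma concave_bound_card : concave_bound (#|K|%:R * B `^ q).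
Proof.
move=> J p b p0 b1 pb.
apply: (@le_trans _ _ (\sum_j p j * (B `^ q * \sum_k normc (b j k)))).
  apply: ler_sum => j _; apply: ler_wpM2l => //.
  pose l := \big[Num.max/0]_k normc (b j k).
  have l0 : 0 <= l by exact: bigmax_ge_id.
  have l1 : l <= 1 by apply: bigmax_le.
  have lS : l <= \sum_k normc (b j k).
    apply: bigmax_le => [|k _]; first by apply: sumr_ge0 => k _; exact: normc_ge0.
    by rewrite (bigD1 k)//= lerDl sumr_ge0// => k' _; exact: normc_ge0.
  apply: (@le_trans _ _ ((l * B) `^ q)).
    apply: ge0_ler_powR; rewrite ?nnegrE ?rnorm_ge0//.
      by apply: mulr_ge0 => //; exact: ltW.
    by apply: rnorm_bound_scale => // k; exact: le_bigmax.
  rewrite powRM ?(ltW B0)// mulrC ler_wpM2l ?powR_ge0//; apply: le_trans lS.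
  have [->|ln0] := eqVneq l 0; first by rewrite powR0 ?gt_eqF.
  have lp : 0 < l by rewrite lt_neqAle eq_sym ln0.
  by apply: ge1r_powR; [rewrite lp|].
rewrite -sum1_card natr_sum mulr_suml.
have -> : \sum_j p j * (B `^ q * \sum_k normc (b j k)) =
   \sum_k (\sum_j p j * normc (b j k)) * B `^ q.
  under eq_bigr do rewrite mulrA mulr_sumr.
  rewrite exchange_big/=; apply: eq_bigr => k _; rewrite mulr_suml.
  by apply: eq_bigr => j _; rewrite mulrAC.
by apply: ler_sum => k _; apply: ler_wpM2r; rewrite ?powR_ge0.
Qed.

(** Chosen so that the loss 2^q of splitting a q-th power, times the gain 2 / L on the part above
    [L], equals 1/2. *)
Let L : R := 4 * 2 `^ q.
Let A : R := 2 `^ q * (C * (L * B) `^ q).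

Lemma V_split (b : K -> R[i]) (P : pred K) :
  V b = V (fun k => if P k then b k else 0) + V (fun k => if P k then 0 else b k).
Proof.
rewrite /V -big_split; apply: eq_bigr => k _ /=.
by case: (P k); rewrite scale0r ?addr0 ?add0r.
Qed.

(* Weights p_j are replaced by N independent samples with law p_j / N. The
   total h of the sampled |b_j| at a point has second moment at most 2: where
   h <= L the samples form a family to which cotype applies directly, and the
   part on h > L is again a weighted family, with a total smaller by 2 / L. *)
Lemma concave_bound_improve (Psi : R) : 0 <= Psi ->
  concave_bound Psi -> concave_bound (A + Psi / 2).
Proof.
move=> Psi0 hPsi J p b p0 b1 pb.
have p2 : 0 < 2 `^ q :> R by exact: powR_gt0.
have L0 : 0 < L by apply: mulr_gt0.
pose P := \sum_j p j.
pose N := (Num.truncn P).+1.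
have PN : P < N%:R by exact: truncnS_gt.
have N0 : 0 < N%:R :> R by [].
(* The outcome [None] takes up the mass missing from the p_j / N and carries the zero function,
   which makes [w] a probability law. *)
pose w (o : option J) := if o is Some j then p j / N%:R else 1 - P / N%:R.
pose c (o : option J) := if o is Some j then b j else fun _ => 0.
have sumo (F : option J -> R) : \sum_o F o = F None + \sum_j F (Some j).
  rewrite (bigD1 None)//=; congr (_ + _).
  rewrite (reindex_omap Some id)/=; last by case.
  by apply: eq_bigl => j; rewrite eqxx.
have w0 o : 0 <= w o.
  case: o => [j|] /=; first by apply: divr_ge0.
  by rewrite subr_ge0 ler_pdivrMr// mul1r ltW.
have w1 : \sum_o w o = 1 by rewrite sumo/= -mulr_suml subrK.
have c1 o k : normc (c o k) <= 1.
  by case: o => [j|]; [exact: b1|rewrite /c normc0 ler01].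
pose pr (s : {ffun 'I_N -> option J}) := \prod_i w (s i).
have pr0 s : 0 <= pr s by exact: prodr_ge0.
pose h (s : {ffun 'I_N -> option J}) k := \sum_i normc (c (s i) k).
have h0 s k : 0 <= h s k by apply: sumr_ge0 => i _; exact: normc_ge0.
have V0 : rnorm (V (c None)) `^ q = 0.
  by rewrite /V big1 ?rnorm0 ?powR0 ?gt_eqF// => k _; rewrite scale0r.
have -> : \sum_j p j * rnorm (V (b j)) `^ q =
    \sum_s pr s * \sum_i rnorm (V (c (s i))) `^ q.
  under [RHS]eq_bigr do rewrite mulr_sumr.
  rewrite exchange_big/=.
  under [RHS]eq_bigr => i _ do
    rewrite (sample1 w1 i (fun o => rnorm (V (c o)) `^ q)).
  rewrite sumr_const card_ord -mulr_natl sumo V0 mulr0 add0r mulr_sumr.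
  by apply: eq_bigr => j _ /=; rewrite mulrA [N%:R * _]mulrC divfK ?gt_eqF.
pose lo (s : {ffun 'I_N -> option J}) i k := if h s k <= L then c (s i) k else 0.
pose hi (s : {ffun 'I_N -> option J}) i k := if h s k <= L then 0 else c (s i) k.
have Elo s : \sum_i rnorm (V (lo s i)) `^ q <= C * (L * B) `^ q.
  apply: disjoint_concave => // k.
  have [hL|hL] := leP (h s k) L.
    by apply: le_trans hL; apply: ler_sum => i _; rewrite /lo;
      case: ifP; rewrite ?normc0 ?normc_ge0.
  rewrite big1 ?(ltW L0)// => i _; by rewrite /lo ifF ?normc0// leNgt hL.
have Ehi : \sum_s pr s * \sum_i rnorm (V (hi s i)) `^ q <= 2 / L * Psi.
  pose J' : finType := ({ffun 'I_N -> option J} * 'I_N)%type.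
  (* These weights are admissible: where h > L one has (L / 2) h <= h^2 / 2, and the second moment
     of h is at most 2. *)
  have := hPsi J' (fun t => pr t.1 * (L / 2)) (fun t => hi t.1 t.2).
  have -> : \sum_(t : J') pr t.1 * (L / 2) * rnorm (V (hi t.1 t.2)) `^ q =
    (L / 2) * \sum_s pr s * \sum_i rnorm (V (hi s i)) `^ q.
    rewrite mulr_sumr -(pair_bigA _ (fun s i => pr s * (L / 2) * rnorm (V (hi s i)) `^ q))/=.
    apply: eq_bigr => s _; rewrite [RHS]mulrCA !mulr_sumr.
    by apply: eq_bigr => i _; rewrite [RHS]mulrA.
  rewrite -[2 / L]invf_div ler_pdivlMl ?divr_gt0//; apply.
  - by move=> t; rewrite mulr_ge0// divr_ge0// ltW.
  - by move=> t k; rewrite /hi; case: ifP; rewrite ?normc0 ?ler01.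
  move=> k.
  have M2 : \sum_s pr s * h s k ^+ 2 <= 2.
    apply: (sample_second_moment w0 w1 (F := fun o => normc (c o k))).
      by move=> o; rewrite normc_ge0 c1.
    rewrite sumo normc0 mulr0 add0r mulr_sumr; apply: le_trans (pb k).
    by apply: ler_sum => j _; rewrite mulrA [N%:R * _]mulrC divfK ?gt_eqF.
  have : \sum_s pr s * (h s k ^+ 2 / 2) <= 1.
    by under eq_bigr do rewrite mulrA; rewrite -mulr_suml; lra.
  apply: le_trans.
  rewrite -(pair_bigA _ (fun s i => pr s * (L / 2) * normc (hi s i k)))/=.
  apply: ler_sum => s _; rewrite -mulr_sumr -mulrA ler_wpM2l//.
  have [hL|hL] := leP (h s k) L.
    by rewrite big1 ?mulr0 ?divr_ge0 ?sqr_ge0// => i _; rewrite /hi ifT ?normc0.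
  have -> : \sum_i normc (hi s i k) = h s k.
    by apply: eq_bigr => i _; rewrite /hi leNgt hL.
  rewrite mulrAC ler_wpM2r// expr2 ler_wpM2r//; exact: ltW.
apply: (@le_trans _ _ (\sum_s pr s * (2 `^ q * (\sum_i rnorm (V (lo s i)) `^ q +
    \sum_i rnorm (V (hi s i)) `^ q)))).
  apply: ler_sum => s _; rewrite ler_wpM2l// -big_split mulr_sumr/=.
  apply: ler_sum => i _; rewrite (V_split _ (fun k => h s k <= L)).
  apply: le_trans (powRD_le q0 (rnorm_ge0 _) (rnorm_ge0 _)).
  by apply: ge0_ler_powR; rewrite ?nnegrE ?addr_ge0 ?rnorm_ge0// rnormD.
under eq_bigr do rewrite mulrCA mulrDr.
rewrite -mulr_sumr big_split/= mulrDr; apply: lerD.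
  rewrite ler_wpM2l ?(ltW p2)//.
  apply: (@le_trans _ _ (\sum_s pr s * (C * (L * B) `^ q))).
    by apply: ler_sum => s _; rewrite ler_wpM2l.
  by rewrite -mulr_suml (sample_total _ w1) mul1r.
apply: le_trans (ler_wpM2l (ltW p2) Ehi) _.
rewrite /L le_eqVlt; apply/orP; left; apply/eqP.
by field; rewrite gt_eqF.
Qed.

(** The map Psi -> A + Psi / 2 has the fixed point 2 A. Iterating it halves the excess over 2 A each
    time, so the dependence on #|K| disappears in the limit. *)
Lemma concave_bound_limit : concave_bound (2 * A).
Proof.
have A0 : 0 <= A by rewrite mulr_ge0 ?powR_ge0// mulr_ge0 ?powR_ge0.
pose e0 := #|K|%:R * B `^ q.
have e00 : 0 <= e0 by rewrite mulr_ge0 ?powR_ge0.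
have H n : concave_bound (2 * A + e0 / 2 ^+ n).
  elim: n => [|n IH].
    rewrite expr0 divr1 => J p b p0 b1 pb.
    by apply: le_trans (concave_bound_card p0 b1 pb) _; rewrite lerDr mulr_ge0.
  rewrite (_ : _ + _ = A + (2 * A + e0 / 2 ^+ n) / 2).
    by apply: concave_bound_improve => //; apply: addr_ge0;
      [exact: mulr_ge0|apply: divr_ge0 => //; exact: exprn_ge0].
  by rewrite exprS; field; rewrite expf_neq0.
move=> J p b p0 b1 pb; apply/ler_addgt0Pr => e egt0.
pose n := (Num.truncn (e0 / e)).+1.
apply: le_trans (H n J p b p0 b1 pb) _; rewrite lerD2l.
rewrite ler_pdivrMr ?exprn_gt0// mulrC -ler_pdivrMr//.
have : e0 / e < n%:R by exact: truncnS_gt.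
move=> /ltW/le_trans; apply; rewrite -natrX ler_nat.
exact/ltnW/ltn_expl.
Qed.

End cotype_concavity.

(** * Dyadic level sets and the square function estimate *)

Section level_sets.
Context {R : realType}.

Lemma half_geometric_le (n : nat) : \sum_(j < n) (2^-1 : R) ^+ j <= 2.
Proof.
suff -> : \sum_(j < n) (2^-1 : R) ^+ j = 2 - 2 * 2^-1 ^+ n.
  by rewrite gerBl mulr_ge0// exprn_ge0.
elim: n => [|n IH]; first by rewrite big_ord0 expr0 mulr1 subrr.
by rewrite big_ord_recr/= IH exprS; field.
Qed.

(** A substitute for Hoelder's inequality: with S the sum on the right, a_j <= 2^-j S^(1/q), and
    these bounds form a geometric series. *)
Lemma powR_sum_le (q : R) (n : nat) (a : 'I_n -> R) : 0 < q ->
  (forall j, 0 <= a j) ->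
  (\sum_(j < n) a j) `^ q <= 2 `^ q * \sum_(j < n) (2 ^+ j * a j) `^ q.
Proof.
move=> q0 a0; set S := \sum_(j < n) (2 ^+ j * a j) `^ q.
have S0 : 0 <= S by apply: sumr_ge0 => j _; exact: powR_ge0.
have aS j : a j <= 2^-1 ^+ j * S `^ q^-1.
  have p0 : 0 <= 2 ^+ j * a j by rewrite mulr_ge0// exprn_ge0.
  rewrite exprVn ler_pdivlMl ?exprn_gt0//.
  have -> : 2 ^+ j * a j = ((2 ^+ j * a j) `^ q) `^ q^-1.
    by rewrite -powRrM divff ?gt_eqF// powRr1.
  apply: ge0_ler_powR; rewrite ?nnegrE ?invr_ge0 ?(ltW q0)// ?powR_ge0//.
  by rewrite /S (bigD1 j)//= lerDl sumr_ge0// => i _; exact: powR_ge0.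
have : \sum_(j < n) a j <= 2 * S `^ q^-1.
  apply: le_trans (ler_sum _ (fun j _ => aS j)) _.
  by rewrite -mulr_suml ler_wpM2r ?powR_ge0// half_geometric_le.
move=> /(ge0_ler_powR (ltW q0)); rewrite !nnegrE sumr_ge0// mulr_ge0 ?powR_ge0//.
move=> /(_ isT isT) /le_trans; apply.
by rewrite powRM ?powR_ge0// -powRrM mulVf ?gt_eqF// powRr1.
Qed.

(** The value at j = 0 is false by convention, so that level 0 collects all z with |z| < 2, small
    ones included, while level j > 0 is 2^j <= |z| < 2^(j+1). *)
Definition below (j : nat) (x : R) : bool := if j is 0 then false else x < 2 ^+ j.
Definition level (j : nat) (z : R[i]) : R[i] :=
  if ~~ below j (normc z) && below j.+1 (normc z) then z else 0.

Lemma belowS j x : below j x -> below j.+1 x.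
Proof.
case: j => //= j /lt_le_trans; apply.
by rewrite ler_pMl ?exprn_gt0// ler1n.
Qed.

Lemma sum_level n z : \sum_(j < n) level j z = if below n (normc z) then z else 0.
Proof.
elim: n => [|n IH]; first by rewrite big_ord0.
rewrite big_ord_recr IH /level; have := @belowS n (normc z).
by do 2![case: below] => //=; rewrite ?addr0 ?add0r// => /(_ isT).
Qed.

Lemma normc_level_le j z : normc (level j z) <= 2 ^+ j.+1.
Proof.
rewrite /level; case: ifP => [/andP[_ /ltW//]|_].
by rewrite normc0 exprn_ge0.
Qed.

(** Chebyshev's inequality, pointwise: a z on the level satisfies 1 <= (|z| / 2^j)^r. Level 0 has no
    such lower bound. *)
Lemma normc_level_moment j r z : (0 < j)%N ->
  normc (level j z) <= 2 ^+ j.+1 * ((2 ^+ j)^-1 ^+ r * normc z ^+ r).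
Proof.
case: j => // j _; have := normc_level_le j.+1 z; rewrite /level.
case: ifP => [/andP[jz _]|_ _]; last first.
  rewrite normc0; apply: mulr_ge0; first exact: exprn_ge0.
  apply: mulr_ge0; apply: exprn_ge0; last exact: normc_ge0.
  by rewrite invr_ge0; exact: exprn_ge0.
move=> /le_trans; apply; rewrite ler_peMr ?exprn_ge0// -exprMn exprn_ege1//.
by rewrite ler_pdivlMl ?exprn_gt0// mulr1 leNgt.
Qed.

End level_sets.

Section square_function.
Context {R : realType} (X : normedModType R[i]) (q : R).
Hypothesis q2 : 2 <= q.
Let q_gt0 : 0 < q. Proof. exact: lt_le_trans q2. Qed.
Context (K : finType) (v : K -> X).
Let V (b : K -> R[i]) : X := \sum_k b k *: v k.

(** Level j, scaled to modulus at most 1, has mean modulus at most M 2^(-rj) at every k, and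
    [concave_bound] converts this into a bound on its contribution. Undoing the scaling and summing
    the levels costs 2^q twice per level; the hypothesis on r leaves a series of ratio at most
    1/2. *)
Lemma level_decomposition (Psi M : R) (r : nat) (D : finType) (f : D -> K -> R[i]) :
  concave_bound q v Psi -> 0 <= Psi -> 1 <= M -> (0 < #|D|)%N ->
  2 * (2 `^ q) ^+ 2 <= 2 ^+ r ->
  (forall k, \sum_e normc (f e k) ^+ r <= M * #|D|%:R) ->
  \sum_e rnorm (V (f e)) `^ q <= 2 * (2 `^ q) ^+ 2 * M * Psi * #|D|%:R.
Proof.
move=> hPsi Psi0 M1 D0 hr hM.
have D0' : 0 < #|D|%:R :> R by rewrite ltr0n.
have M0 : 0 < M by apply: lt_le_trans M1.
pose n := (Num.truncn (\sum_e \sum_k normc (f e k))).+1.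
have fn e k : below n (normc (f e k)).
  apply: (@lt_trans _ _ n%:R); last by rewrite /= -natrX ltr_nat ltn_expl.
  apply: le_lt_trans (truncnS_gt _).
  rewrite (bigD1 e)//= (bigD1 k)//= -addrA lerDl addr_ge0// sumr_ge0// => i _.
    exact: normc_ge0.
  by apply: sumr_ge0 => j _; exact: normc_ge0.
pose b (j : nat) e k := level j (f e k) / (2 ^+ j.+1)%:C%C.
have nC (j : nat) : normc ((2 ^+ j)%:C%C : R[i]) = 2 ^+ j.
  by rewrite normc_real ger0_norm// exprn_ge0.
have bE j e k : normc (b j e k) = normc (level j (f e k)) / 2 ^+ j.+1.
  by rewrite normcM normcV nC.
have b1 j e k : normc (b j e k) <= 1.
  by rewrite bE ler_pdivrMr ?exprn_gt0// mul1r normc_level_le.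
pose T : R := (2 ^+ r)^-1.
have T0 : 0 < T by rewrite invr_gt0 exprn_gt0.
have bT j k : \sum_e normc (b j e k) <= T ^+ j * M * #|D|%:R.
  case: j => [|j].
    rewrite expr0 mul1r; apply: (@le_trans _ _ (\sum_(e : D) 1)).
      by apply: ler_sum => e _.
    by rewrite sumr_const ler_peMl.
  rewrite -mulrA; apply: le_trans (ler_wpM2l _ (hM k)); last by rewrite exprn_ge0// ltW.
  rewrite mulr_sumr; apply: ler_sum => e _; rewrite bE ler_pdivrMr ?exprn_gt0//.
  rewrite mulrC; have := normc_level_moment r (f e k) (ltn0Sn j).
  by rewrite (_ : T ^+ j.+1 = (2 ^+ j.+1)^-1 ^+ r)// /T !exprVn -!exprM mulnC.
have VbT j : \sum_e rnorm (V (b j e)) `^ q <= T ^+ j * M * #|D|%:R * Psi.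
  have c0 : 0 < T ^+ j * M * #|D|%:R by rewrite !mulr_gt0// exprn_gt0.
  rewrite mulrC -ler_pdivrMr// mulrC mulr_sumr; apply: hPsi => // [e|k].
    by rewrite invr_ge0 ltW.
  by rewrite -mulr_sumr ler_pdivrMl// mulr1.
have Vf e : rnorm (V (f e)) <= \sum_(j < n) 2 ^+ j.+1 * rnorm (V (b j e)).
  have -> : V (f e) = \sum_(j < n) (2 ^+ j.+1)%:C%C *: V (b j e).
    under [RHS]eq_bigr do rewrite scaler_sumr.
    rewrite exchange_big/=; apply: eq_bigr => k _.
    rewrite -[f e k in LHS](_ : \sum_(j < n) level j (f e k) = _); last by rewrite sum_level fn.
    rewrite scaler_suml; apply: eq_bigr => j _.
    by rewrite scalerA mulrC divfK// fmorph_eq0 expf_neq0.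
  apply: le_trans (rnorm_sum _ _ _) _; apply: ler_sum => j _.
  by rewrite rnormZ nC.
pose G := (2 `^ q : R).
have G0 : 0 <= G by exact: powR_ge0.
have G2 j : (2 ^+ j) `^ q = G ^+ j.
  by rewrite -powR_mulrn// -powRrM mulrC powRrM powR_mulrn ?powR_ge0.
apply: (@le_trans _ _ (\sum_e G * \sum_(j < n) G ^+ j * G ^+ j.+1 * rnorm (V (b j e)) `^ q)).
  apply: ler_sum => e _.
  apply: (@le_trans _ _ ((\sum_(j < n) 2 ^+ j.+1 * rnorm (V (b j e))) `^ q)).
    apply: ge0_ler_powR; rewrite ?nnegrE ?rnorm_ge0// ?(ltW q_gt0)// sumr_ge0// => j _.
    by rewrite mulr_ge0 ?exprn_ge0 ?rnorm_ge0.
  apply: le_trans (powR_sum_le _ _) _ => // [j|].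
    by rewrite mulr_ge0 ?exprn_ge0 ?rnorm_ge0.
  rewrite ler_wpM2l//; apply: ler_sum => j _.
  by rewrite mulrA powRM ?mulr_ge0 ?exprn_ge0 ?rnorm_ge0// powRM ?exprn_ge0// !G2.
rewrite -mulr_sumr exchange_big/=.
under eq_bigr do rewrite -mulr_sumr.
apply: (@le_trans _ _ (G * \sum_(j < n) (2^-1) ^+ j * (G * M * #|D|%:R * Psi))).
  rewrite ler_wpM2l//; apply: ler_sum => j _.
  apply: le_trans (ler_wpM2l _ (VbT j)) _; first by rewrite mulr_ge0 ?exprn_ge0.
  rewrite [leLHS](_ : _ = (G ^+ 2 * T) ^+ j * (G * M * #|D|%:R * Psi)); last first.
    by rewrite exprMn -exprM mul2n -addnn exprD exprS; ring.
  rewrite ler_wpM2r ?mulr_ge0 ?(ltW M0)//.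
  rewrite lerXn2r ?nnegrE ?mulr_ge0 ?exprn_ge0 ?(ltW T0)//.
  by rewrite /T ler_pdivrMr ?exprn_gt0// ler_pdivlMl// mulrC.
rewrite -mulr_suml.
apply: (@le_trans _ _ (G * (2 * (G * M * #|D|%:R * Psi)))).
  by rewrite ler_wpM2l// ler_wpM2r ?half_geometric_le// !mulr_ge0 ?(ltW M0).
by rewrite le_eqVlt; apply/orP; left; apply/eqP; rewrite /G; ring.
Qed.

(** The outer [C] comes from applying cotype to the vectors V (g_i), the inner one from its use in
    [concave_bound_limit]; r is large enough for 2 G^2 <= 2^r. *)
Definition square_function_const (C : R) : R :=
  let G := 2 `^ q in let r := (Num.truncn (2 * G ^+ 2)).+1 in
  C * (2 * G ^+ 2 * (1 + rademacher_const r) * (2 * (G * (C * (4 * G) `^ q)))).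

Lemma rademacher_const_ge0 r : 0 <= rademacher_const r :> R.
Proof.
by rewrite /rademacher_const mulr_ge0 ?exprn_ge0// !mulr_ge0 ?exprn_ge0 ?expR_ge0.
Qed.

Lemma square_function_const_ge0 (C : R) : 0 < C -> 0 <= square_function_const C.
Proof.
move=> /ltW C0; have G0 := powR_ge0 (2 : R) q.
have G20 : 0 <= 2 * (2 `^ q) ^+ 2 :> R by rewrite mulr_ge0 ?exprn_ge0.
apply: mulr_ge0 => //; apply: mulr_ge0.
  by apply: mulr_ge0 => //; apply: addr_ge0 => //; exact: rademacher_const_ge0.
by do 3![apply: mulr_ge0 => //]; exact: powR_ge0.
Qed.

(** Cotype reduces the sum to the mean of |V (sum_i +- z_i g_i)|^q over signs. At each k the squares
    of the |g i k| sum to at most 1, so the sign sums have bounded moments of every order and can be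
    cut into levels, with the sign vectors as [D]. *)
Lemma square_function_le (C B : R) (I : finType) (g : I -> K -> R[i]) :
  0 < C -> 0 < B -> sign_cotype X q C ->
  (forall b : K -> R[i], (forall k, normc (b k) <= 1) -> rnorm (V b) <= B) ->
  (forall k, \sum_i normc (g i k) ^+ 2 <= 1) ->
  \sum_i rnorm (V (g i)) `^ q <= square_function_const C * B `^ q.
Proof.
move=> C0 B0 hC hB hg.
set G := 2 `^ q; set r := (Num.truncn (2 * G ^+ 2)).+1.
have G0 : 0 < G by exact: powR_gt0.
pose Psi := 2 * (G * (C * (4 * G * B) `^ q)).
have rc0 := rademacher_const_ge0 r.
have Psi0 : 0 < Psi by rewrite !mulr_gt0 ?powR_gt0// !mulr_gt0.
(* The summand 1 makes the moment bound at least 1, as required for the lowest level, which is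
   estimated by counting. *)
pose A := 2 * G ^+ 2 * (1 + rademacher_const r) * Psi.
have rc1 : 0 < 1 + rademacher_const r :> R by rewrite (lt_le_trans ltr01)// lerDl.
have A0 : 0 < A.
  by apply: mulr_gt0 => //; apply: mulr_gt0 => //; apply: mulr_gt0 => //; exact: exprn_gt0.
have -> : square_function_const C * B `^ q = C * A.
  rewrite /square_function_const -/G -/r /A /Psi.
  rewrite [(4 * G * B) `^ q]powRM ?mulr_ge0 ?(ltW G0) ?(ltW B0)//; ring.
apply: (hC I _ A A0) => z z1.
under eq_bigr => e _.
  rewrite (_ : \sum_i _ = V (fun k => \sum_i (-1) ^+ e i * (z i * g i k))); last first.
    rewrite /V; under eq_bigr do rewrite scaler_sumr.
    rewrite exchange_big/=; apply: eq_bigr => k _.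
    by rewrite scaler_suml; apply: eq_bigr => i _; rewrite scalerA mulrA.
  over.
apply: (level_decomposition (concave_bound_limit q2 B0 (ltW C0) hC hB) (ltW Psi0)).
- by rewrite lerDl.
- by rewrite card_ffun expn_gt0 card_bool.
- rewrite -/G; apply: le_trans (ltW (truncnS_gt _)) _.
  by rewrite -natrX ler_nat; exact/ltnW/ltn_expl.
move=> k; apply: le_trans (rademacher_moment_complex _ _) _.
  apply: le_trans (hg k); apply: ler_sum => i _.
  by rewrite normcM z1 mul1r.
by rewrite ler_wpM2r// lerDr.
Qed.

End square_function.

(** * Homogeneous polynomials on roots of unity *)

Section circle.
Context {R : realType}.
Implicit Types s t : R.

Lemma circle_ptD s t : circle_pt (s + t) = circle_pt s * circle_pt t.
Proof.
rewrite /circle_pt mulrDr cosD sinD; apply/eqP.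
by rewrite eq_complex/= eqxx/= addrC [cos _ * sin _]mulrC.
Qed.

Lemma circle_pt0 : circle_pt 0 = 1 :> R[i].
Proof. by rewrite /circle_pt mulr0 cos0 sin0. Qed.

Lemma circle_pt1 : circle_pt 1 = 1 :> R[i].
Proof. by rewrite /circle_pt mulr1 mulr_natl cos2pi sin2pi. Qed.

Lemma circle_ptM (n : nat) t : circle_pt (n%:R * t) = circle_pt t ^+ n.
Proof.
elim: n => [|n IH]; first by rewrite mul0r circle_pt0.
by rewrite exprS -IH -circle_ptD -nat1r mulrDl mul1r.
Qed.

Lemma normc_circle_pt t : normc (circle_pt t) = 1.
Proof. by rewrite /normc/= cos2Dsin2 sqrtr1. Qed.

Lemma circle_ptN t : circle_pt (- t) = (circle_pt t)^*%C.
Proof. by rewrite /circle_pt mulrN cosN sinN. Qed.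

Lemma circle_pt_neq1 s : 0 < s < 1 -> circle_pt s != 1.
Proof.
move=> /andP[s0 s1]; apply/eqP => /(congr1 (@complex.Re R)) /=.
rewrite (_ : 2 * pi * s = pi * s + pi * s); last by ring.
rewrite cosD -!expr2; have := cos2Dsin2 (pi * s).
have : 0 < sin (pi * s).
  by apply: sin_gt0_pi; rewrite ?mulr_gt0 ?pi_gt0//= gtr_pMr ?pi_gt0.
move=> /(exprn_gt0 2); lra.
Qed.

End circle.

Section roots_of_unity.
Context {R : realType} (d M : nat).
Local Notation W := {ffun 'I_d -> 'I_M.+1}.

Definition grid_pt (w : W) (i : 'I_d) : R[i] := circle_pt ((w i)%:R / M.+1%:R).

Definition grid_monomial (w : W) (e : 'I_d -> nat) : R[i] :=
  \prod_i grid_pt w i ^+ e i.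

(** In each coordinate this is a geometric sum over the roots of unity of order M + 1. Distinct
    exponents in [0, M] are incongruent modulo M + 1, so its ratio is not 1 and it vanishes. *)
Lemma grid_orthogonal (e e' : {ffun 'I_d -> nat}) :
  (forall i, e i <= M)%N -> (forall i, e' i <= M)%N ->
  \sum_w grid_monomial w e * (grid_monomial w e')^*%C =
  if e == e' then #|{: W}|%:R else 0.
Proof.
move=> eM e'M.
pose x (i : 'I_d) : R[i] := circle_pt (((e i)%:R - (e' i)%:R) / M.+1%:R).
have -> : \sum_w grid_monomial w e * (grid_monomial w e')^*%C =
    \prod_i \sum_(j < M.+1) x i ^+ j.
  rewrite bigA_distr_bigA/=; apply: eq_bigr => w _.
  rewrite /grid_monomial rmorph_prod -big_split/=; apply: eq_bigr => i _.
  rewrite rmorphXn [X in _ * X ^+ _](_ : _ = circle_pt (- ((w i)%:R / M.+1%:R))).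
    2: by rewrite circle_ptN.
  rewrite /grid_pt /x -!circle_ptM -circle_ptD.
  by congr circle_pt; ring.
have [ee'|ee'] := eqVneq e e'.
  rewrite (eq_bigr (fun=> M.+1%:R)); last first.
    move=> i _; rewrite /x ee' subrr mul0r circle_pt0.
    by under eq_bigr do rewrite expr1n; rewrite sumr_const card_ord.
  by rewrite prodr_const card_ffun !card_ord natrX.
have [i ii'] : exists i, e i != e' i.
  apply/existsP; apply: contraNT ee' => /existsPn h.
  by apply/eqP/ffunP => i; apply/eqP; have := h i; rewrite negbK.
have xM : x i ^+ M.+1 = 1.
  rewrite /x -circle_ptM mulrC divfK ?pnatr_eq0//.
  by rewrite circle_ptD circle_ptN -[(e i)%:R]mulr1 -[(e' i)%:R]mulr1
    !circle_ptM circle_pt1 !expr1n rmorph1 mulr1.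
have x1 : x i != 1.
  have [le|lt|/eqP] := ltngtP (e i) (e' i); last by rewrite (negbTE ii').
    rewrite /x -opprB mulNr circle_ptN.
    rewrite -(inj_eq (can_inj (@conjcK R))) conjcK rmorph1 -natrB 1?ltnW//.
    apply: circle_pt_neq1; rewrite divr_gt0 ?ltr0n ?subn_gt0//=.
    rewrite ltr_pdivrMr// mul1r ltr_nat ltnS.
    by apply: leq_trans (e'M i); exact: leq_subr.
  rewrite /x -natrB 1?ltnW//.
  apply: circle_pt_neq1; rewrite divr_gt0 ?ltr0n ?subn_gt0//=.
  rewrite ltr_pdivrMr// mul1r ltr_nat ltnS.
  by apply: leq_trans (eM i); exact: leq_subr.
rewrite (bigD1 i)//= (_ : \sum_(j < M.+1) x i ^+ j = 0) ?mul0r//.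
apply: (mulfI (x := x i - 1)); first by rewrite subr_eq0.
by rewrite mulr0 -subrX1 xM subrr.
Qed.

Context (P : finType) (c : P -> R[i]) (E : P -> {ffun 'I_d -> nat}).
Hypothesis EM : forall p i, (E p i <= M)%N.

Lemma grid_second_moment :
  (\sum_w normc (\sum_p c p * grid_monomial w (E p)) ^+ 2)%:C%C =
  \sum_p \sum_(p' | E p == E p') c p * (c p')^*%C * #|{: W}|%:R.
Proof.
rewrite rmorph_sum/=.
transitivity (\sum_w \sum_p \sum_p' c p * (c p')^*%C *
   (grid_monomial w (E p) * (grid_monomial w (E p'))^*%C)).
  apply: eq_bigr => w _; rewrite rmorphXn/= -normcEC sqr_normc rmorph_sum/=.
  rewrite big_distrlr/=; apply: eq_bigr => p _; apply: eq_bigr => p' _.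
  by rewrite rmorphM/=; ring.
rewrite exchange_big/=; apply: eq_bigr => p _.
rewrite exchange_big/= [RHS]big_mkcond/=; apply: eq_bigr => p' _.
by rewrite -mulr_sumr grid_orthogonal//; case: ifP => // _; rewrite mulr0.
Qed.

Lemma grid_second_moment_inj : injective E ->
  \sum_w normc (\sum_p c p * grid_monomial w (E p)) ^+ 2 =
  (\sum_p normc (c p) ^+ 2) * #|{: W}|%:R.
Proof.
move=> Einj; apply: complexI; rewrite grid_second_moment.
rewrite rmorphM/= rmorph_nat rmorph_sum/= mulr_suml; apply: eq_bigr => p _.
rewrite (bigD1 p)//= big1 ?addr0; last first.
  by move=> p' /andP[/eqP/Einj -> /eqP].
by rewrite -sqr_normc normcEC rmorphXn.
Qed.

(** Only pairs with equal exponents survive; |c_p c_p'| is at most the mean of the two squares, and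
    every p has at most k partners, itself included. *)
Lemma grid_second_moment_le (k : nat) :
  (forall p, #|[pred p' | E p == E p']| <= k)%N ->
  \sum_w normc (\sum_p c p * grid_monomial w (E p)) ^+ 2 <=
  k%:R * (\sum_p normc (c p) ^+ 2) * #|{: W}|%:R.
Proof.
move=> Ek; have := congr1 (@complex.Re R) grid_second_moment => /= ->.
have -> : complex.Re (\sum_p \sum_(p' | E p == E p') c p * (c p')^*%C * #|{: W}|%:R) =
    (\sum_p \sum_(p' | E p == E p') complex.Re (c p * (c p')^*%C)) * #|{: W}|%:R.
  rewrite raddf_sum mulr_suml; apply: eq_bigr => p _ /=.
  rewrite raddf_sum mulr_suml; apply: eq_bigr => p' _ /=.
  by rewrite !mulr_natr raddfMn.
rewrite ler_wpM2r//.
apply: (@le_trans _ _ (\sum_p \sum_(p' | E p == E p') (normc (c p) ^+ 2 + normc (c p') ^+ 2) / 2)).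
  apply: ler_sum => p _; apply: ler_sum => p' _.
  apply: le_trans (ler_norm _) _; apply: le_trans (Re_le_normc _) _.
  have -> : normc (c p * (c p')^*%C) = normc (c p) * normc (c p').
    by rewrite normcM; congr (_ * _); apply: complexI; rewrite -!normcEC normcJ.
  have := sqr_ge0 (normc (c p) - normc (c p')); rewrite sqrrB; lra.
rewrite [leLHS](_ : _ = \sum_p \sum_(p' | E p == E p') normc (c p) ^+ 2); last first.
  transitivity (\sum_p \sum_(p' | E p == E p') (normc (c p) ^+ 2) / 2 +
     \sum_p \sum_(p' | E p == E p') (normc (c p') ^+ 2) / 2).
    rewrite -big_split; apply: eq_bigr => p _ /=.
    by rewrite -big_split; apply: eq_bigr => p' _ /=; rewrite mulrDl.
  rewrite [X in _ + X](exchange_big_dep xpredT)//=.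
  rewrite -big_split; apply: eq_bigr => p _ /=.
  under [X in _ + X]eq_bigl do rewrite eq_sym.
  by rewrite -big_split; apply: eq_bigr => p' _ /=; lra.
rewrite mulr_sumr; apply: ler_sum => p _.
rewrite sumr_const -[leLHS]mulr_natl ler_wpM2r ?sqr_ge0// ler_nat; exact: Ek.
Qed.

End roots_of_unity.

(** * L^2 and L^1 norms of scalar homogeneous polynomials *)

Section homogeneous_polynomials.
Context {R : realType} (d m : nat).
(** Exponents in the square of the polynomial reach 2m, so roots of unity of order 2m + 1 keep
    distinct monomials orthogonal for both the polynomial and its square. *)
Local Notation M := (2 * m)%N.
Local Notation W := {ffun 'I_d -> 'I_M.+1}.
Context (I : finType) (e : I -> {ffun 'I_d -> 'I_M.+1}).
Hypothesis einj : injective e.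
Hypothesis em : forall a, (\sum_i e a i)%N = m.

(** There are prod (g i + 1) such f, and n + 1 <= 2^n. An element of [W] is read here as a
    multi-index, not as a grid point. *)
Lemma card_multiindex_le (g : 'I_d -> nat) :
  (#|[pred f : W | [forall i, f i <= g i]]| <= 2 ^ \sum_i g i)%N.
Proof.
rewrite -sum1_card big_mkcond/=.
have -> : (\sum_(f : W) (if f \in [pred f : W | [forall i, f i <= g i]] then 1 else 0) =
    \sum_(f : W) \prod_i (f i <= g i))%N.
  apply: eq_bigr => f _; rewrite inE; case: forallP => [h|/forallP].
    by rewrite big1// => i _; rewrite h.
  by rewrite negb_forall => /existsP[i /negbTE h]; rewrite (bigD1 i)//= h.
rewrite -(bigA_distr_bigA (fun (i : 'I_d) (j : 'I_M.+1) => nat_of_bool (j <= g i)%N))/=.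
rewrite expn_sum; apply: leq_prod => i _.
apply: leq_trans (ltn_expl (g i) (ltnSn 1)).
rewrite -big_mkcond/= sum1_card.
rewrite -[X in (_ <= X)%N]card_ord.
pose h (j : 'I_M.+1) : 'I_(g i).+1 := inord j.
rewrite -(card_in_imset (f := h)) ?max_card//.
move=> j j' jg j'g /(congr1 val)/=.
have {}jg : (j <= g i)%N := jg; have {}j'g : (j' <= g i)%N := j'g.
by rewrite !inordK// => /val_inj.
Qed.

Definition expo (a : I) : {ffun 'I_d -> nat} := [ffun i => e a i : nat].
Let expo2 (p : I * I) : {ffun 'I_d -> nat} := [ffun i => (e p.1 i + e p.2 i)%N].

Let e_le a i : (e a i <= m)%N.
Proof. by apply: leq_trans (eq_leq (em a)); rewrite (bigD1 i)//= leq_addr. Qed.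

(** A pair with prescribed sum of exponents is determined by its first member, which is dominated by
    that sum, a multi-index of degree 2m. *)
Lemma card_pairs_le (p : I * I) : (#|[pred p' | expo2 p == expo2 p']| <= 4 ^ m)%N.
Proof.
have -> : (4 ^ m = 2 ^ \sum_i expo2 p i)%N.
  under eq_bigr do rewrite ffunE.
  by rewrite big_split/= !em addnn -mul2n expnM.
apply: leq_trans (card_multiindex_le _).
rewrite -(card_in_imset (f := fun p' : I * I => e p'.1)).
    apply/subset_leq_card/fintype.subsetP => f /imsetP[p' ]; rewrite !inE => /eqP -> ->.
  by apply/forallP => i; rewrite ffunE leq_addr.
move=> [a b] [a1 b1]; rewrite !inE /= => /eqP h1 /eqP h2 /einj ea.
rewrite ea; congr (_, _); apply: einj; apply/ffunP => i; apply/val_inj => /=.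
have := congr1 (fun u : {ffun 'I_d -> nat} => u i) (etrans (esym h1) h2).
by rewrite !ffunE/= ea => /addnI.
Qed.

(** Instead of interpolating between L^1 and L^4, the pointwise inequality x^2 <= t x + x^4 / t^2 is
    summed over the grid. *)
Lemma homogeneous_L2_L1 (c : I -> R[i]) : (0 < m)%N ->
  Num.sqrt (\sum_a normc (c a) ^+ 2) * #|{: W}|%:R <=
  6 ^+ m * \sum_(w : W) normc (\sum_a c a * grid_monomial w (expo a)).
Proof.
move=> m0; pose p (w : W) := \sum_a c a * grid_monomial w (expo a).
set s := \sum_a normc (c a) ^+ 2.
have nW : 0 < #|{: W}|%:R :> R.
  by rewrite ltr0n card_ffun expn_gt0 card_ord.
have s0 : 0 <= s by apply: sumr_ge0 => a _; exact: sqr_ge0.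
have S0 : 0 <= \sum_w normc (p w) by apply: sumr_ge0 => w _; exact: normc_ge0.
have [->|sn0] := eqVneq s 0.
  by rewrite sqrtr0 mul0r mulr_ge0// exprn_ge0.
have s_gt0 : 0 < s by rewrite lt_neqAle eq_sym sn0.
have P2 : \sum_w normc (p w) ^+ 2 = s * #|{: W}|%:R.
  apply: grid_second_moment_inj => [a i|a b].
    by rewrite ffunE; apply: leq_trans (e_le a i) _; exact: leq_pmull.
  move=> /ffunP h; apply: einj; apply/ffunP => i; apply/val_inj.
  by have := h i; rewrite !ffunE.
have P4 : \sum_w normc (p w) ^+ 4 <= 4 ^+ m * s ^+ 2 * #|{: W}|%:R.
  have -> : s ^+ 2 = \sum_(ab : I * I) normc (c ab.1 * c ab.2) ^+ 2.
    rewrite expr2 big_distrlr/= pair_bigA/=; apply: eq_bigr => ab _.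
    by rewrite normcM exprMn.
  have -> : 4 ^+ m = (4 ^ m)%:R :> R by rewrite natrX.
  apply: le_trans (grid_second_moment_le _ _ _); last exact: card_pairs_le.
    apply: ler_sum => w _.
    rewrite [leLHS](_ : _ = normc (p w ^+ 2) ^+ 2); last by rewrite normcX -exprM.
    rewrite [p w ^+ 2]expr2 /p big_distrlr/= pair_bigA/=.
    rewrite le_eqVlt; apply/orP; left; apply/eqP; congr (normc _ ^+ _).
    apply: eq_bigr => ab _; rewrite mulrACA; congr (_ * _).
    rewrite /grid_monomial -big_split/=; apply: eq_bigr => i _.
    by rewrite !ffunE exprD.
  move=> ab i; rewrite ffunE; apply: (@leq_trans (m + m)); first exact: leq_add.
  by rewrite mul2n addnn.
set u := Num.sqrt s.
have u0 : 0 < u by rewrite sqrtr_gt0.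
have u2 : u ^+ 2 = s by rewrite sqr_sqrtr.
(* With this [t] the fourth-power term is at most a quarter of the second moment and is absorbed on
   the left. The remaining factor 8/3 * 2^m is at most 6^m because m >= 1. *)
pose t := 2 * 2 ^+ m * u.
have t0 : 0 < t by rewrite !mulr_gt0 ?exprn_gt0.
have t2 : t ^+ 2 = 4 * (4 ^+ m * s).
  by rewrite /t !exprMn u2 -exprM mulnC exprM (_ : 2 ^+ 2 = 4 :> R); ring.
have key : \sum_w normc (p w) ^+ 2 <=
    t * (\sum_w normc (p w)) + (\sum_w normc (p w) ^+ 4) / t ^+ 2.
  rewrite mulr_sumr mulr_suml -big_split/=; apply: ler_sum => w _.
  have x0 := normc_ge0 (p w); move: (normc (p w)) x0 => x x0.
  have [xt|/ltW xt] := leP x t.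
    rewrite -[leLHS]addr0; apply: lerD; first by rewrite expr2 ler_wpM2r.
    by apply: divr_ge0; apply: exprn_ge0 => //; exact: ltW.
  rewrite -[leLHS]add0r; apply: lerD; first by rewrite mulr_ge0 ?(ltW t0).
  rewrite ler_pdivlMr ?exprn_gt0// [leRHS](_ : _ = x ^+ 2 * x ^+ 2); last by ring.
  by rewrite ler_wpM2l ?sqr_ge0// lerXn2r ?nnegrE ?(ltW t0).
move: key; rewrite P2 => key.
have k4 : (\sum_w normc (p w) ^+ 4) / t ^+ 2 <= s * #|{: W}|%:R / 4.
  rewrite ler_pdivrMr ?exprn_gt0//; apply: le_trans P4 _.
  by rewrite t2 le_eqVlt; apply/orP; left; apply/eqP; field.
have k3 : s * #|{: W}|%:R <= 4 / 3 * (t * \sum_w normc (p w)) by lra.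
have k5 : u * #|{: W}|%:R <= 4 / 3 * (2 * 2 ^+ m) * \sum_w normc (p w).
  rewrite -(ler_pM2l u0) [leLHS]mulrA -[u * u]/(u ^+ 2) u2; apply: le_trans k3 _.
  by rewrite /t le_eqVlt; apply/orP; left; apply/eqP; ring.
apply: le_trans k5 _; rewrite ler_wpM2r//.
rewrite (_ : 6 = 3 * 2); last by ring.
rewrite exprMn mulrA ler_wpM2r ?exprn_ge0//.
have : 3 <= 3 ^+ m :> R by rewrite ler_eXnr// ler1n.
lra.
Qed.

End homogeneous_polynomials.

(** * Averaging over rotations of the torus *)

Section rotation.
Context {R : realType}.
Notation RR := (measurableTypeR R).
Implicit Types s t : R.

Definition rot (s t : R) : R := if t + s < 1 then t + s else t + s - 1.

Lemma circle_pt_rot s t : circle_pt (rot s t) = circle_pt s * circle_pt t.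
Proof.
rewrite -circle_ptD /rot addrC; case: ifP => // _.
by rewrite -[in RHS](subrK 1 (s + t)) [in RHS]circle_ptD circle_pt1 mulr1.
Qed.

Lemma measurable_rot s : measurable_fun setT (rot s : RR -> RR).
Proof.
have m1 : measurable_fun setT ((fun t => t + s) : RR -> RR).
  by apply: measurable_funD => //; exact: measurable_cst.
apply: measurable_fun_if => //.
- by apply: measurable_fun_ltr => //; exact: measurable_cst.
- exact: measurable_funS m1.
- apply: measurable_funB; last exact: measurable_cst.
  exact: measurable_funS m1.
Qed.

Let P : probability RR R := uniform_prob (@ltr01 R).

(** Both sides are finite measures in A, so it is enough to compare them on rays. For 0 <= x < s the
    preimage of ]x, +oo[ consists of two intervals, because of the wrap-around at 1. *)
Lemma uniform_prob_rot s (A : set RR) : 0 <= s < 1 -> measurable A ->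
  P (rot s @^-1` A) = P A.
Proof.
move=> /andP[s0 s1] mA.
have [m1 m1E] := UniformSequence.pushm P (measurable_rot s).
rewrite -m1E; apply: (UniformSequence.ray_unique (m1 := m1) (m2 := P)) => // x; last first.
  rewrite m1E; apply: le_lt_trans (probability_le1 _ _) (ltry 1).
  by rewrite -[X in measurable X]setTI; apply: measurable_rot => //; exact: measurable_itv.
rewrite m1E [RHS](UniformSequence.P_ray x).
rewrite [LHS](UniformSequence.P_E (A := rot s @^-1` `]x, +oo[%classic)); last first.
  by rewrite -[X in measurable X]setTI; apply: measurable_rot => //; exact: measurable_itv.
have rotE t (Q : Prop) : (t + s < 1 -> x < t + s -> Q) ->
    (1 <= t + s -> x < t + s - 1 -> Q) -> x < rot s t -> Q.
  by rewrite /rot; case: ltP => ? h1 h2; [apply: h1|apply: h2].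
have rotI1 t : t + s < 1 -> x < t + s -> x < rot s t by rewrite /rot => ->.
have rotI2 t : 1 <= t + s -> x < t + s - 1 -> x < rot s t.
  by move=> h; rewrite /rot (ltNge (t + s)) h.
case: ltP => x0; last case: ltP => x1.
- rewrite (_ : _ `&` _ = `[0, 1]%classic).
    by rewrite lebesgue_measure_itv/= lte_fin ltr01 -EFinD subr0.
  apply/seteqP; split => t /=; rewrite !in_itv/= ?andbT; first by case.
  move=> /andP[t0 t1]; split; last by rewrite t0 t1.
  by have [h|h] := ltP (t + s) 1; [apply: rotI1|apply: rotI2] => //; lra.
- have [xs|xs] := ltP x s.
    rewrite (_ : _ `&` _ = `[0, 1 - s[%classic `|` `](x + 1 - s), 1]%classic); last first.
      apply/seteqP; split => t /=; rewrite !in_itv/= ?andbT.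
        move=> [h /andP[t0 t1]]; apply: (rotE t _ _ _ h) => h1 h2; [left|right].
          by rewrite t0/=; lra.
        by rewrite t1 andbT; lra.
      move=> [/andP[h1 h2]|/andP[h1 h2]].
        by split; [apply: rotI1; lra|apply/andP; split; lra].
      by split; [apply: rotI2; lra|apply/andP; split; lra].
    rewrite measureU//=; last first.
      apply/seteqP; split => t //=; rewrite !in_itv/= => -[/andP[h1 h2] /andP[h3 h4]]; lra.
    rewrite [X in (X + _)%E]lebesgue_measure_itv [X in (_ + X)%E]lebesgue_measure_itv/= !lte_fin.
    by rewrite !ifT -?EFinD//; try (congr _%:E); lra.
  rewrite (_ : _ `&` _ = `](x - s), 1 - s[%classic).
    by rewrite lebesgue_measure_itv/= lte_fin ifT -?EFinD//; try (congr _%:E); lra.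
  apply/seteqP; split => t /=; rewrite !in_itv/= ?andbT.
    by move=> [h /andP[t0 t1]]; apply: (rotE t _ _ _ h) => h1 h2; apply/andP; split; lra.
  by move=> /andP[h1 h2]; split; [apply: rotI1; lra|apply/andP; split; lra].
- rewrite (_ : _ `&` _ = set0) ?measure0//.
  apply/seteqP; split => t //=; rewrite !in_itv/= ?andbT.
  by move=> [h /andP[t0 t1]]; apply: (rotE t _ _ _ h) => h1 h2; lra.
Qed.

End rotation.

Section cube_rotation.
Context {I : countType} {R : realType}.
Notation RR := (measurableTypeR R).
Notation Q := (cube I R).

Definition cube_rot (s t : I -> R) : I -> R := fun i => rot (s i) (t i).

Lemma measurable_coord (i : I) : measurable_fun setT ((fun t => t i) : Q -> RR).
Proof.
move=> _ A mA; rewrite setTI; apply: sub_sigma_algebra.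
by exists i, A.
Qed.

Lemma measurable_cube_rot (s : I -> R) : measurable_fun setT (cube_rot s : Q -> Q).
Proof.
apply: (@measurability _ _ _ _ _ (cube_rot s : Q -> Q) (@cylinders I R)) => //.
move=> _ [_ [i [A [mA ->]]] <-].
exact: (measurableT_comp (measurable_rot (s i)) (measurable_coord i)).
Qed.

Let boxes : set (set Q) := [set B | exists (J : {fset I}) (A : I -> set RR),
  (forall i, measurable (A i)) /\ B = [set t | forall i, i \in J -> A i (t i)]].

Lemma cube_measure_rot (s : I -> R) (B : set Q) :
  (forall i, 0 <= s i < 1) -> measurable B ->
  cube_measure I R (cube_rot s @^-1` B) = cube_measure I R B.
Proof.
move=> s01 mB.
have [m1 m1E] := UniformSequence.pushm (cube_measure I R) (measurable_cube_rot s).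
rewrite -m1E.
have mbox (J : {fset I}) (A : I -> set RR) : (forall i, measurable (A i)) ->
    measurable ([set t | forall i, i \in J -> A i (t i)] : set Q).
  move=> mA.
  rewrite (_ : [set _ | _] = \bigcap_(i in [set` J]) [set t : Q | A i (t i)])//.
  apply: fin_bigcap_measurable => // i _.
  by rewrite -[X in measurable X]setTI; exact: measurable_coord.
apply: (measure_unique boxes (fun=> setT) _ _ _ _ m1 (cube_measure I R)) => //.
- rewrite eqEsubset; split => C.
    apply: smallest_sub; first exact: smallest_sigma_algebra.
    move=> _ [i [A [mA ->]]]; apply: sub_sigma_algebra.
    exists [fset i]%fset, (fun=> A); split=> //.
    apply/seteqP; split => t /= h; last by apply: h; rewrite inE.
    by move=> j; rewrite inE => /eqP ->.
  apply: smallest_sub; first exact: sigma_algebra_measurable.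
  by move=> _ [J [A [mA ->]]]; exact: mbox.
- move=> _ _ [J [A [mA ->]]] [J' [A' [mA' ->]]].
  exists (J `|` J')%fset, (fun i => (if i \in J then A i else setT) `&`
     (if i \in J' then A' i else setT)); split.
    by move=> i; apply: measurableI; case: ifP.
  apply/seteqP; split => t /=.
    by move=> [h h'] i _; split; case: ifP => // /[dup] iJ; [move/h|move/h'].
  move=> h; split => i iJ; have := h i; rewrite inE iJ/= ?orbT => /(_ isT).
    by case.
  by case.
- move=> _; exists fset0, (fun=> setT); split=> //.
  by apply/seteqP; split.
- by rewrite bigcup_const//; exists 0%N.
- move=> _ [J [A [mA ->]]]; rewrite m1E.
  apply: etrans (cube_measureE J (A := fun i => rot (s i) @^-1` A i) _) _.
    by move=> i; rewrite -[X in measurable X]setTI; exact: measurable_rot.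
  apply/esym; apply: etrans (cube_measureE J mA) _.
  by apply: eq_bigr => i _; exact: esym (uniform_prob_rot (s01 i) (mA i)).
- move=> _; rewrite m1E.
  by rewrite preimage_setT; apply: le_lt_trans (ltry 1);
    rewrite -(probability_setT (cube_measure I R)).
Qed.

Lemma torus_int_rot (s : I -> R) (f : (I -> R[i]) -> R) :
  (forall i, 0 <= s i < 1) -> (forall z, 0 <= f z) ->
  measurable_fun setT ((fun t => f (fun i => circle_pt (t i))) : Q -> RR) ->
  torus_int f = torus_int (fun z => f (fun i => circle_pt (s i) * z i)).
Proof.
move=> s01 f0 mf; rewrite /torus_int.
pose mu := cube_measure I R.
pose F (t : Q) : \bar R := (f (fun i => circle_pt (t i)))%:E.
have mF : measurable_fun setT F by apply/measurable_EFinP.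
transitivity (\int[mu]_t (F \o cube_rot s) t)%E; last first.
  apply: eq_integral => t _; rewrite /F /=; congr (f _)%:E.
  by apply/funext => i; rewrite circle_pt_rot.
have := ge0_integral_pushforward (measurable_cube_rot s) mu measurableT mF _.
rewrite preimage_setT => <-; last by move=> t _; rewrite lee_fin.
apply: esym; apply: (eq_measure_integral mu) => [|mr A mA _]; first exact: measurable_cube_rot.
exact: (cube_measure_rot s01 mA).
Qed.

(* Averaging over rotations replaces the torus by a finite group; this is the
   only way the integral enters the rest of the argument. *)
Section torus_average.
Context (f : (I -> R[i]) -> R) (W : finType) (s : W -> I -> R).
Hypothesis W0 : (0 < #|W|)%N.
Hypothesis s01 : forall w i, 0 <= s w i < 1.
Hypothesis f0 : forall z, 0 <= f z.
Hypothesis mf :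
  measurable_fun setT ((fun t => f (fun i => circle_pt (t i))) : Q -> RR).
Hypothesis mfs : forall w, measurable_fun setT
  ((fun t => f (fun i => circle_pt (s w i) * circle_pt (t i))) : Q -> RR).

Let avg (z : I -> R[i]) : R := \sum_w f (fun i => circle_pt (s w i) * z i).
Let N : R := #|W|%:R.
Let N0 : 0 < N. Proof. by rewrite ltr0n. Qed.

Let torus_int_avg : (N%:E * torus_int f = torus_int avg)%E.
Proof.
have -> : (torus_int avg = \sum_(w : W) torus_int f)%E.
  rewrite {1}/torus_int; under eq_integral do rewrite -sumEFin.
  rewrite ge0_integral_sum//.
  - by apply: eq_bigr => w _; rewrite (torus_int_rot (s01 w)).
  - by move=> w; apply/measurable_EFinP; exact: mfs.
  - by move=> w t _; rewrite lee_fin.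
rewrite /N -sum1_card natr_sum -sumEFin ge0_sume_distrl//.
by apply: eq_bigr => w _; rewrite mul1e.
Qed.

Let mavg : measurable_fun setT
  ((fun t => (avg (fun i => circle_pt (t i)))%:E) : Q -> \bar R).
Proof.
apply/measurable_EFinP; rewrite /avg.
by apply: measurable_sum => w; exact: mfs.
Qed.

Let avg0 z : 0 <= avg z. Proof. by apply: sumr_ge0. Qed.

Lemma torus_int_le (A : R) : 0 <= A ->
  (forall z, (forall i, normc (z i) = 1) -> avg z <= A * N) ->
  (torus_int f <= A%:E)%E.
Proof.
move=> A0 hA; rewrite -(lee_pmul2l (x := N%:E))// ?lte_fin// torus_int_avg.
rewrite -EFinM mulrC -[leRHS]mule1 -(probability_setT (cube_measure I R)).
rewrite -integral_cst//; apply: ge0_le_integral => //.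
- by move=> t _; rewrite lee_fin.
- by move=> t _; rewrite lee_fin; apply: hA => i; exact: normc_circle_pt.
Qed.

Lemma torus_int_ge (A : R) : 0 <= A ->
  (forall z, (forall i, normc (z i) = 1) -> A * N <= avg z) ->
  (A%:E <= torus_int f)%E.
Proof.
move=> A0 hA; rewrite -(lee_pmul2l (x := N%:E))// ?lte_fin// torus_int_avg.
rewrite -EFinM mulrC -[leLHS]mule1 -(probability_setT (cube_measure I R)).
rewrite -integral_cst//; apply: ge0_le_integral => //.
- by move=> t _; rewrite lee_fin mulr_ge0// ltW.
- by move=> t _; rewrite lee_fin; apply: hA => i; exact: normc_circle_pt.
Qed.

End torus_average.

End cube_rotation.

(** * Measurability of norms of vector-valued polynomials *)

Section measurable_rnorm.
Context {R : realType} d (T : measurableType d) (X : normedModType R[i]).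
Notation RR := (measurableTypeR R).

(* X need not be separable, so measurability of |g + r y + x| is obtained from
   that of its value at the rational approximations of r. *)
Lemma measurable_rnorm_addZ (g : T -> X) (r : T -> RR) (y : X) :
  (forall x, measurable_fun setT ((fun t => rnorm (g t + x)) : T -> RR)) ->
  measurable_fun setT r ->
  forall x, measurable_fun setT ((fun t => rnorm (g t + (r t)%:C%C *: y + x)) : T -> RR).
Proof.
move=> mg mr x.
apply: (measurability _ (measurable_realfun.RGenInftyO.measurableE R)).
move=> _ [_ [lam ->] <-]; rewrite setTI.
pose h (p : rat) t : R := rnorm (g t + ((ratr p)%:C%C *: y + x)) + `|r t - ratr p| * rnorm y.
have -> : (fun t => rnorm (g t + (r t)%:C%C *: y + x)) @^-1` `]-oo, lam[ =
    \bigcup_p (h p @^-1` `]-oo, lam[).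
  apply/seteqP; split => t /=; rewrite ?in_itv/=; last first.
    move=> [p _]; rewrite /= in_itv/=; apply: le_lt_trans.
    rewrite [X in rnorm X](_ : _ = (g t + ((ratr p)%:C%C *: y + x)) + (r t - ratr p)%:C%C *: y).
      by apply: le_trans (rnormD _ _) _; rewrite rnormZ normc_real.
    rewrite rmorphB/= scalerBl -!addrA; congr (_ + _).
    by rewrite [RHS]addrCA [X in _ = _ + X]addrCA subrr addr0 addrC.
  move=> tl; pose e := (lam - rnorm (g t + (r t)%:C%C *: y + x)) / (2 * (rnorm y + 1)).
  have y0 := rnorm_ge0 y.
  have e0 : 0 < e by rewrite divr_gt0 ?subr_gt0// mulr_gt0// ltr_wpDl.
  have re : r t < r t + e by rewrite ltrDl.
  have [p] := rat_in_itvoo re; rewrite in_itv/= => /andP[p1 p2].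
  exists p => //=; rewrite in_itv/= /h.
  have rp : `|r t - ratr p| <= e by rewrite ler_norml; apply/andP; split; lra.
  have n1 : rnorm (g t + ((ratr p)%:C%C *: y + x)) <=
      rnorm (g t + (r t)%:C%C *: y + x) + e * rnorm y.
    rewrite [X in rnorm X](_ : _ = (g t + (r t)%:C%C *: y + x) + (ratr p - r t)%:C%C *: y).
      apply: le_trans (rnormD _ _) _; rewrite rnormZ normc_real distrC.
      by rewrite lerD2l ler_wpM2r.
    rewrite rmorphB/= scalerBl -!addrA; congr (_ + _).
    by rewrite [RHS]addrCA [X in _ = _ + X]addrCA subrr addr0 addrC.
  have n2 : `|r t - ratr p| * rnorm y <= e * rnorm y by rewrite ler_wpM2r.
  apply: le_lt_trans (lerD n1 n2) _.
  have : e * (2 * (rnorm y + 1)) = lam - rnorm (g t + (r t)%:C%C *: y + x).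
    by rewrite /e divfK// mulf_neq0// gt_eqF// ltr_wpDl.
  lra.
apply: bigcupT_measurable_rat => p.
rewrite -[X in measurable X]setTI.
have mh : measurable_fun setT (h p : T -> RR).
  apply: measurable_funD; first exact: mg.
  apply: measurable_funM; last exact: measurable_cst.
  apply: (measurableT_comp (@normr_measurable R setT)).
  by apply: measurable_funB => //; exact: measurable_cst.
by apply: mh => //; exact: measurable_itv.
Qed.

Definition cmeasurable (f : T -> R[i]) : Prop :=
  measurable_fun setT ((fun t => complex.Re (f t)) : T -> RR) /\
  measurable_fun setT ((fun t => complex.Im (f t)) : T -> RR).

Lemma cmeasurable_cst (c : R[i]) : cmeasurable (fun=> c).
Proof. by split; exact: measurable_cst. Qed.

Lemma cmeasurableM (f g : T -> R[i]) :
  cmeasurable f -> cmeasurable g -> cmeasurable (fun t => f t * g t).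
Proof.
move=> [f1 f2] [g1 g2]; split.
  rewrite (_ : (fun t => _) = fun t =>
      complex.Re (f t) * complex.Re (g t) - complex.Im (f t) * complex.Im (g t)).
    by apply: measurable_funB; apply: measurable_funM.
  by apply/funext => t; case: (f t) => a b; case: (g t).
rewrite (_ : (fun t => _) = fun t =>
    complex.Re (f t) * complex.Im (g t) + complex.Im (f t) * complex.Re (g t)).
  by apply: measurable_funD; apply: measurable_funM.
by apply/funext => t; case: (f t) => a b; case: (g t).
Qed.

Lemma cmeasurable_prod (J : Type) (s : seq J) (f : J -> T -> R[i]) :
  (forall j, cmeasurable (f j)) -> cmeasurable (fun t => \prod_(j <- s) f j t).
Proof.
move=> mf; elim: s => [|j s IH].
  by under eq_fun do rewrite big_nil; exact: cmeasurable_cst.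
by under eq_fun do rewrite big_cons; exact: cmeasurableM.
Qed.

Lemma cmeasurableX (f : T -> R[i]) n : cmeasurable f -> cmeasurable (fun t => f t ^+ n).
Proof.
move=> mf; elim: n => [|n IH].
  by under eq_fun do rewrite expr0; exact: cmeasurable_cst.
by under eq_fun do rewrite exprS; exact: cmeasurableM.
Qed.

Lemma measurable_rnorm_sum (J : Type) (s : seq J) (f : J -> T -> R[i]) (y : J -> X) :
  (forall j, cmeasurable (f j)) ->
  measurable_fun setT ((fun t => rnorm (\sum_(j <- s) f j t *: y j)) : T -> RR).
Proof.
move=> mf.
(* All translates by x are carried along, since [measurable_rnorm_addZ] asks for them. It is applied
   twice per term: to the real part of the coefficient with y_j, and to the imaginary part with i
   y_j. *)
suff H x : measurable_fun setT ((fun t => rnorm (\sum_(j <- s) f j t *: y j + x)) : T -> RR).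
  by have := H 0; under eq_fun do rewrite addr0.
elim: s x => [|j s IH] x.
  by under eq_fun do rewrite big_nil; exact: measurable_cst.
have [mRe mIm] := mf j.
have := measurable_rnorm_addZ (g := fun t => \sum_(j <- s) f j t *: y j +
  (complex.Re (f j t))%:C%C *: y j) ('i%C *: y j)
  (measurable_rnorm_addZ (y j) IH mRe) mIm x.
congr (measurable_fun _ _); apply/funext => t; congr (rnorm (_ + _)).
rewrite big_cons [RHS]addrC -addrA; congr (_ + _).
by rewrite scalerA -scalerDl mulrC -complexE.
Qed.

End measurable_rnorm.

(** * From torus averages to sign averages *)

Section sign_cotype.
Context {R : realType}.
Notation RR := (measurableTypeR R).

Lemma cmeasurable_circle_pt (I : countType) (i : I) :
  cmeasurable ((fun t => circle_pt (t i)) : cube I R -> R[i]).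
Proof.
have m1 : measurable_fun setT ((fun t => 2 * pi * t i) : cube I R -> RR).
  by apply: measurable_funM; [exact: measurable_cst|exact: measurable_coord].
split; rewrite /circle_pt/=.
  exact: (measurableT_comp (continuous_measurable_fun (@continuous_cos R)) m1).
exact: (measurableT_comp (continuous_measurable_fun (@continuous_sin R)) m1).
Qed.

Lemma circle_pt_half : circle_pt 2^-1 = -1 :> R[i].
Proof.
rewrite /circle_pt (_ : 2 * pi * 2^-1 = pi); last by field.
by rewrite cospi sinpi; apply/eqP; rewrite eq_complex/= oppr0 !eqxx.
Qed.

(** A power-mean inequality with a factor 2 to spare. It follows from a^2 <= B^2 (1 + a^q / A) with
    B = A^(1/q), which holds both for a <= B and for a >= B. *)
Lemma powR_mean_le (q : R) (I : finType) (a : I -> R) (A : R) : 2 <= q -> 0 < A ->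
  (forall i, 0 <= a i) -> \sum_i a i `^ q <= A * #|I|%:R ->
  \sum_i a i ^+ 2 <= 2 * A `^ (2 / q) * #|I|%:R.
Proof.
move=> q2 A0 a0 aq.
have q0 : 0 < q by apply: lt_le_trans q2.
pose B := A `^ q^-1.
have B0 : 0 < B by exact: powR_gt0.
have BA : B `^ q = A by rewrite /B -powRrM mulVf ?gt_eqF// powRr1// ltW.
have B2 : A `^ (2 / q) = B ^+ 2.
  by rewrite mulrC powRrM -/B -powR_mulrn// ltW.
have H i : a i ^+ 2 <= B ^+ 2 * (1 + a i `^ q / A).
  pose t := a i / B.
  have aE : a i = B * t by rewrite /t mulrC divfK// gt_eqF.
  have t0 : 0 <= t by rewrite divr_ge0// ltW.
  rewrite aE exprMn powRM ?(ltW B0)// BA [A * _]mulrC mulfK ?gt_eqF//.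
  rewrite ler_pM2l ?exprn_gt0//.
  have [t1|/ltW t1] := leP t 1.
    by apply: le_trans (exprn_ile1 2 t0 t1) _; rewrite lerDl powR_ge0.
  apply: (@le_trans _ _ (t `^ q)); last by rewrite lerDr.
  by rewrite -powR_mulrn//; apply: ler_powR.
apply: le_trans (ler_sum _ (fun i _ => H i)) _.
rewrite -mulr_sumr big_split/= sumr_const -mulr_suml B2.
rewrite [leRHS](_ : _ = B ^+ 2 * (2 * #|I|%:R)); last by ring.
rewrite ler_pM2l ?exprn_gt0//.
have : (\sum_i a i `^ q) / A <= #|I|%:R by rewrite ler_pdivrMr// mulrC.
lra.
Qed.

Lemma cotype_sign_cotype (X : completeNormedModType R[i]) (q : R) : 2 <= q ->
  cotype X q -> exists2 C : R, 0 < C & sign_cotype X q C.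
Proof.
move=> q2 [C C0 hC].
have q0 : 0 < q by apply: lt_le_trans q2.
exists ((C * Num.sqrt 2) `^ q); first by rewrite powR_gt0 ?mulr_gt0 ?sqrtr_gt0.
move=> I x A A0 hx.
pose N := #|I|; pose y (k : 'I_N) := x (enum_val k).
have -> : \sum_i rnorm (x i) `^ q = \sum_(k < N) rnorm (y k) `^ q.
  rewrite (reindex (@enum_val I I))//=; apply: onW_bij; exact: enum_val_bij.
pose S := \sum_(k < N) rnorm (y k) `^ q.
have S0 : 0 <= S by apply: sumr_ge0 => k _; exact: powR_ge0.
pose M : R := 2 * A `^ (2 / q).
have M0 : 0 <= M by rewrite mulr_ge0 ?powR_ge0.
have int_le : (torus_int (fun z : 'I_N -> R[i] => (rnorm (\sum_(k < N) z k *: y k) ^+ 2)%R)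
    <= M%:E)%E.
  (* The points 0 and 1/2 are sent to 1 and -1 by [circle_pt], so these rotations form the group of
     sign changes. *)
  pose s (w : {ffun I -> bool}) (k : 'I_N) : R := if w (enum_val k) then 2^-1 else 0.
  have cs w k : circle_pt (s w k) = (-1) ^+ w (enum_val k) :> R[i].
    by rewrite /s; case: (w _); rewrite ?circle_pt_half ?circle_pt0.
  apply: (torus_int_le (s := s)) => //.
  - by rewrite card_ffun expn_gt0 card_bool.
  - by move=> w k; rewrite /s; case: (w _); apply/andP; split; lra.
  - by move=> z; exact: sqr_ge0.
  - apply: measurable_funX; apply: measurable_rnorm_sum => k.
    exact: cmeasurable_circle_pt.
  - move=> w; apply: measurable_funX.
    apply: (@measurable_rnorm_sum _ _ _ _ _ _ (fun k (t : cube _ R) =>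
      circle_pt (s w k) * circle_pt (t k))) => k.
    by apply: cmeasurableM; [exact: cmeasurable_cst|exact: cmeasurable_circle_pt].
  move=> z z1; apply: powR_mean_le => // [w|]; first exact: rnorm_ge0.
  have := hx (fun i => z (enum_rank i)) (fun i => z1 _); apply: le_trans.
  apply: ler_sum => w _; rewrite le_eqVlt; apply/orP; left; apply/eqP.
  congr (rnorm _ `^ _).
  rewrite [RHS](reindex (@enum_val I I))/=; last by apply: onW_bij; exact: enum_val_bij.
  by apply: eq_bigr => k _; rewrite cs enum_valK.
have int_ge0 : (0 <=
    torus_int (fun z : 'I_N -> R[i] => (rnorm (\sum_(k < N) z k *: y k) ^+ 2)%R))%E.
  by apply: integral_ge0 => t _; rewrite lee_fin sqr_ge0.
have : S `^ q^-1 <= C * Num.sqrt M.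
  rewrite -lee_fin; apply: le_trans (hC N y) _.
  rewrite EFinM lee_wpmul2l ?lee_fin ?(ltW C0)//.
  rewrite -powR12_sqrt// -poweR_EFin.
  by apply: gt0_ler_poweR => //; rewrite in_itv/= leey andbT ?lee_fin.
move=> /(ge0_ler_powR (ltW q0)); rewrite !nnegrE powR_ge0 mulr_ge0 ?sqrtr_ge0 ?(ltW C0)//.
move=> /(_ isT isT); rewrite -powRrM mulVf ?gt_eqF// powRr1//.
move/le_trans; apply.
rewrite /M sqrtrM// mulrA powRM ?mulr_ge0 ?sqrtr_ge0 ?(ltW C0)//.
rewrite ler_wpM2l ?powR_ge0//.
have e1 : 2 / q * (2^-1 * q) = 1 by field; rewrite gt_eqF.
by rewrite -(powR12_sqrt (powR_ge0 A _)) -!powRrM e1 powRr1// ltW.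
Qed.

End sign_cotype.

(** * Unconditional bases *)

Section unconditional_contraction.
Context {R : realType} (U : normedModType R[i]) (K : finType) (u : K -> U) (c : R).
Hypothesis c0 : 0 <= c.
Hypothesis hc : forall a eps : K -> R[i], (forall k, normc (eps k) = 1) ->
  rnorm (\sum_k eps k *: (a k *: u k)) <= c * rnorm (\sum_k a k *: u k).

(* A real t in [-1, 1] is the mean of the unimodular t +- i sqrt (1 - t^2). *)
Lemma unconditional_real_multiplier (a : K -> R[i]) (t : K -> R) :
  (forall k, `|t k| <= 1) ->
  rnorm (\sum_k (t k)%:C%C *: (a k *: u k)) <= c * rnorm (\sum_k a k *: u k).
Proof.
move=> t1; pose s k := Num.sqrt (1 - t k ^+ 2).
have s2 k : s k ^+ 2 = 1 - t k ^+ 2.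
  rewrite sqr_sqrtr// subr_ge0 -(expr1n R 2) -(real_normK (num_real (t k))).
  by rewrite lerXn2r ?nnegrE.
pose e1 k : R[i] := (t k +i* s k)%C; pose e2 k : R[i] := (t k -i* s k)%C.
have n1 k : normc (e1 k) = 1 by rewrite /normc/= s2 addrC subrK sqrtr1.
have n2 k : normc (e2 k) = 1 by rewrite /normc/= sqrrN s2 addrC subrK sqrtr1.
have e12 k : e1 k + e2 k = 2%:R * (t k)%:C%C.
  by apply/eqP; rewrite mulr_natl mulr2n eq_complex/= addrN addr0 !eqxx.
have E : 2%:R *: (\sum_k (t k)%:C%C *: (a k *: u k)) =
    \sum_k e1 k *: (a k *: u k) + \sum_k e2 k *: (a k *: u k).
  rewrite scaler_sumr -big_split; apply: eq_bigr => k _ /=.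
  by rewrite scalerA -e12 scalerDl.
have := congr1 (@rnorm R U) E; rewrite rnormZ.
have -> : normc (2%:R : R[i]) = 2.
  by rewrite -(rmorph_nat (@real_complex R)) normc_real ger0_norm.
have := rnormD (\sum_k e1 k *: (a k *: u k)) (\sum_k e2 k *: (a k *: u k)).
have := hc a n1; have := hc a n2; lra.
Qed.

(** The quotients b k / a k lie in the unit disc; their real and imaginary parts cost a factor c
    each. *)
Lemma unconditional_multiplier (a b : K -> R[i]) :
  (forall k, normc (b k) <= normc (a k)) ->
  rnorm (\sum_k b k *: u k) <= 2 * c * rnorm (\sum_k a k *: u k).
Proof.
move=> ba; pose th k := b k / a k.
have thE k : th k * a k = b k.
  have [a0|an0] := eqVneq (a k) 0; last by rewrite /th divfK.
  rewrite a0 mulr0; apply/esym/eq0_normc/eqP.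
  by rewrite eq_le normc_ge0 andbT; have := ba k; rewrite a0 normc0.
have th1 k : normc (th k) <= 1.
  have [a0|an0] := eqVneq (a k) 0; first by rewrite /th a0 invr0 mulr0 normc0.
  rewrite normcM normcV ler_pdivrMr ?mul1r// lt_neqAle normc_ge0 andbT eq_sym.
  by apply: contra an0 => /eqP/eq0_normc ->.
have -> : \sum_k b k *: u k =
    \sum_k (complex.Re (th k))%:C%C *: (a k *: u k) +
    'i%C *: \sum_k (complex.Im (th k))%:C%C *: (a k *: u k).
  rewrite scaler_sumr -big_split; apply: eq_bigr => k _ /=.
  by rewrite [X in _ + X]scalerA -scalerDl -complexE scalerA thE.
apply: le_trans (rnormD _ _) _; rewrite rnormZ.
have -> : normc ('i%C : R[i]) = 1 by rewrite /normc/= expr0n expr1n add0r sqrtr1.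
rewrite mul1r -mulrA mulr_natl mulr2n; apply: lerD.
  apply: unconditional_real_multiplier => k.
  by apply: le_trans (Re_le_normc _) _.
apply: unconditional_real_multiplier => k.
by apply: le_trans (Im_le_normc _) _.
Qed.

End unconditional_contraction.

(** * Transfer through a space with an unconditional basis *)

Section lattice_estimate.
Context {R : realType} (X U : completeNormedModType R[i]) (q : R).
Hypothesis q2 : 2 <= q.
Context (K : finType) (u : K -> U) (c s : R) (S : U -> X).
Hypothesis c0 : 0 <= c.
Hypothesis s0 : 0 <= s.
Hypothesis hc : forall a b : K -> R[i], (forall k, normc (b k) <= normc (a k)) ->
  rnorm (\sum_k b k *: u k) <= c * rnorm (\sum_k a k *: u k).
Hypothesis hSsum : forall b : K -> R[i], S (\sum_k b k *: u k) = \sum_k b k *: S (u k).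
Hypothesis hS : forall y, rnorm (S y) <= s * rnorm y.
Context (d m : nat) (I : finType) (e : I -> {ffun 'I_d -> 'I_(2 * m).+1}).
Hypothesis einj : injective e.
Hypothesis em : forall a, (\sum_i e a i)%N = m.
Hypothesis m0 : (0 < m)%N.
Local Notation W := {ffun 'I_d -> 'I_(2 * m).+1}.

(** The exponent of [c] counts three comparisons of moduli: b_k times the square function against
    the square function, the square function against 6^m times the mean of |p_k|, and |p_k| against
    p_k. *)
Lemma lattice_estimate (C B : R) (a : I -> K -> R[i]) :
  0 < C -> 0 < B -> sign_cotype X q C ->
  s * c ^+ 3 * 6 ^+ m * (\sum_(w : W)
    rnorm (\sum_k (\sum_j a j k * grid_monomial w (expo e j)) *: u k)) <=
    B * #|{: W}|%:R ->
  \sum_j rnorm (S (\sum_k a j k *: u k)) `^ q <= square_function_const q C * B `^ q.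
Proof.
move=> C0 B0 hC hB.
pose sg k := Num.sqrt (\sum_j normc (a j k) ^+ 2).
have sg2 k : sg k ^+ 2 = \sum_j normc (a j k) ^+ 2.
  by rewrite sqr_sqrtr// sumr_ge0// => j _; exact: sqr_ge0.
have sg0 k : 0 <= sg k by exact: sqrtr_ge0.
have nsg k : normc (sg k)%:C%C = sg k by rewrite normc_real ger0_norm.
have asg j k : normc (a j k) <= sg k.
  rewrite -ler_sqr ?nnegrE ?normc_ge0// sg2 (bigD1 j)//= lerDl sumr_ge0// => j' _.
  exact: sqr_ge0.
pose v k := (sg k)%:C%C *: S (u k).
(* Where [sg k] is 0 all the [a j k] vanish, so the value 0 given to the quotient is the right
   one. *)
pose g j k := a j k / (sg k)%:C%C.
have gE j k : g j k * (sg k)%:C%C = a j k.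
  have [sk0|sk] := eqVneq (sg k) 0; last by rewrite /g divfK// fmorph_eq0.
  rewrite sk0 mulr0; apply/esym/eq0_normc/eqP; rewrite eq_le normc_ge0 andbT.
  by rewrite -sk0.
have -> : \sum_j rnorm (S (\sum_k a j k *: u k)) `^ q =
    \sum_j rnorm (\sum_k g j k *: v k) `^ q.
  apply: eq_bigr => j _; congr (rnorm _ `^ _); rewrite hSsum.
  by apply: eq_bigr => k _; rewrite /v scalerA gE.
apply: (square_function_le q2 C0 B0 hC) => [b b1|k]; last first.
  under eq_bigr do rewrite normcM normcV nsg exprMn exprVn.
  rewrite -mulr_suml -sg2.
  have [->|sk] := eqVneq (sg k) 0; first by rewrite expr0n mul0r.
  by rewrite divff// expf_neq0.
have W0 : 0 < #|{: W}|%:R :> R by rewrite ltr0n card_ffun expn_gt0 card_ord.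
have Vb : rnorm (\sum_k b k *: v k) <= s * (c * rnorm (\sum_k (sg k)%:C%C *: u k)).
  have -> : \sum_k b k *: v k = S (\sum_k (b k * (sg k)%:C%C) *: u k).
    by rewrite hSsum; apply: eq_bigr => k _; rewrite /v scalerA.
  apply: le_trans (hS _) _; rewrite ler_wpM2l//; apply: hc => k.
  by rewrite normcM nsg ler_piMl.
apply: le_trans Vb _; rewrite -(ler_pM2r W0); apply: le_trans hB.
pose p (w : W) k := \sum_j a j k * grid_monomial w (expo e j).
pose M k : R := \sum_(w : W) normc (p w k).
have M0 k : 0 <= M k by apply: sumr_ge0 => w _; exact: normc_ge0.
have sgM k : sg k * #|{: W}|%:R <= 6 ^+ m * M k.
  exact: homogeneous_L2_L1.
have st1 : rnorm (\sum_k (sg k)%:C%C *: u k) * #|{: W}|%:R <=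
    c * (6 ^+ m * \sum_(w : W) rnorm (\sum_k (normc (p w k))%:C%C *: u k)).
  have -> : rnorm (\sum_k (sg k)%:C%C *: u k) * #|{: W}|%:R =
      rnorm (\sum_k (sg k * #|{: W}|%:R)%:C%C *: u k).
    have nW : normc (#|{: W}|%:R%:C%C : R[i]) = #|{: W}|%:R.
      by rewrite normc_real ger0_norm.
    rewrite mulrC -[in LHS]nW -rnormZ scaler_sumr; congr rnorm.
    by apply: eq_bigr => k _; rewrite scalerA -rmorphM mulrC.
  apply: (@le_trans _ _ (c * rnorm (\sum_k (6 ^+ m * M k)%:C%C *: u k))).
    by apply: hc => k; rewrite !normc_real !ger0_norm ?mulr_ge0 ?exprn_ge0.
  rewrite ler_wpM2l//.
  have -> : \sum_k (6 ^+ m * M k)%:C%C *: u k =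
      (6 ^+ m)%:C%C *: \sum_(w : W) \sum_k (normc (p w k))%:C%C *: u k.
    rewrite exchange_big/= scaler_sumr; apply: eq_bigr => k _.
    by rewrite -scaler_suml scalerA rmorphM /M rmorph_sum.
  rewrite rnormZ normc_real ger0_norm ?exprn_ge0// ler_wpM2l ?exprn_ge0//.
  exact: rnorm_sum.
have st2 : \sum_(w : W) rnorm (\sum_k (normc (p w k))%:C%C *: u k) <=
    c * \sum_(w : W) rnorm (\sum_k p w k *: u k).
  rewrite mulr_sumr; apply: ler_sum => w _; apply: hc => k.
  by rewrite normc_real ger0_norm ?normc_ge0.
have -> : s * (c * rnorm (\sum_k (sg k)%:C%C *: u k)) * #|{: W}|%:R =
  s * c * (rnorm (\sum_k (sg k)%:C%C *: u k) * #|{: W}|%:R) by ring.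
apply: (@le_trans _ _ (s * c * (c * (6 ^+ m * (c * \sum_(w : W) rnorm (\sum_k p w k *: u k)))))).
  rewrite ler_wpM2l ?mulr_ge0//; apply: le_trans st1 _.
  by rewrite ler_wpM2l// ler_wpM2l// exprn_ge0.
by rewrite le_eqVlt; apply/orP; left; apply/eqP; ring.
Qed.

End lattice_estimate.

Section operators.
Context {R : realType} (X U : completeNormedModType R[i]) (F : set X) (T : X -> U).
Hypothesis F0 : F 0.
Hypothesis Flin : forall c x y, F x -> F y -> F (c *: x + y).
Hypothesis Tlin : linear_on F T.

Lemma linear_on0 : T 0 = 0.
Proof.
have := Tlin 1 F0 F0; rewrite !scale1r addr0 => h.
by apply: (addrI (T 0)); rewrite addr0.
Qed.

Lemma linear_on_sum (I : Type) (r : seq I) (c : I -> R[i]) (x : I -> X) :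
  (forall i, F (x i)) ->
  F (\sum_(i <- r) c i *: x i) /\
  T (\sum_(i <- r) c i *: x i) = \sum_(i <- r) c i *: T (x i).
Proof.
move=> Fx; elim: r => [|i r [IH1 IH2]]; first by rewrite !big_nil linear_on0.
rewrite !big_cons; split; first exact: Flin.
by rewrite Tlin// IH2.
Qed.

Lemma opnorm_ge0 : (0 <= opnorm F T)%E.
Proof.
apply: ereal_sup_ubound => /=; exists 0; last by rewrite linear_on0 rnorm0.
by rewrite rnorm0 ler01; split.
Qed.

Lemma opnorm_bound (t : R) : (opnorm F T <= t%:E)%E -> 0 <= t ->
  forall x, F x -> rnorm (T x) <= t * rnorm x.
Proof.
move=> hT t0 x Fx.
have [x0|xn0] := eqVneq (rnorm x) 0.
  by rewrite (rnorm_eq0 x0) linear_on0 !rnorm0 mulr0.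
have xp : 0 < rnorm x by rewrite lt_neqAle eq_sym xn0 rnorm_ge0.
pose y := ((rnorm x)^-1)%:C%C *: x.
have nr : normc ((rnorm x)^-1)%:C%C = (rnorm x)^-1.
  by rewrite normc_real ger0_norm// invr_ge0 rnorm_ge0.
have Fy : F y by rewrite /y -[_ *: _]addr0; exact: Flin.
have ny : rnorm y = 1 by rewrite rnormZ nr mulVf.
have Ty : T y = ((rnorm x)^-1)%:C%C *: T x.
  by rewrite /y -[_ *: x]addr0 Tlin// linear_on0 addr0.
have : ((rnorm (T y))%:E <= t%:E)%E.
  apply: le_trans hT; apply: ereal_sup_ubound => /=; exists y => //.
  by rewrite ny; split.
by rewrite lee_fin Ty rnormZ nr ler_pdivrMl// mulrC.
Qed.

End operators.

Lemma unconditional_constant_ge0 (R : realType) (U : completeNormedModType R[i])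
    (D : set nat) (u : nat -> U) : (0 <= unconditional_constant D u)%E.
Proof. by apply: le_ereal_inf_tmp => _ [c [c0 _] <-]; rewrite lee_fin. Qed.

Section span.
Context {R : realType} (X : completeNormedModType R[i]) (I : finType) (x : I -> X).

Definition span : set X := [set y | exists c : I -> R[i], y = \sum_i c i *: x i].

Lemma span_mem i : span (x i).
Proof.
exists (fun j => if j == i then 1 else 0).
rewrite (bigD1 i)//= eqxx scale1r big1 ?addr0// => j /negbTE ->.
by rewrite scale0r.
Qed.

Lemma span0 : span 0.
Proof. by exists (fun=> 0); rewrite big1// => i _; rewrite scale0r. Qed.

Lemma span_lin c y z : span y -> span z -> span (c *: y + z).
Proof.
move=> [a ->] [b ->]; exists (fun i => c * a i + b i).
rewrite scaler_sumr -big_split; apply: eq_bigr => i _ /=.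
by rewrite scalerDl scalerA.
Qed.

Lemma finite_dim_span : finite_dim_subspace span.
Proof.
exists #|I|, (fun k => x (enum_val k)).
have re (c : I -> R[i]) : \sum_i c i *: x i = \sum_(k < #|I|) c (enum_val k) *: x (enum_val k).
  rewrite (reindex (@enum_val I I))//=; apply: onW_bij; exact: enum_val_bij.
apply/seteqP; split => y /= [c ->].
  by exists (fun k => c (enum_val k)); rewrite re.
exists (fun i => c (enum_rank i)); rewrite re.
by apply: eq_bigr => k _; rewrite enum_valK.
Qed.

End span.

Section lust_estimate.
Context {R : realType} (X : completeNormedModType R[i]) (q : R).
Hypothesis q2 : 2 <= q.
Context (d m : nat) (I : finType) (e : I -> {ffun 'I_d -> 'I_(2 * m).+1}).
Hypothesis einj : injective e.
Hypothesis em : forall a, (\sum_i e a i)%N = m.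
Hypothesis m0 : (0 < m)%N.
Local Notation W := {ffun 'I_d -> 'I_(2 * m).+1}.

Lemma normc_grid_monomial (w : W) (f : {ffun 'I_d -> nat}) :
  normc (grid_monomial w f : R[i]) = 1.
Proof.
rewrite /grid_monomial normc_prod big1// => i _.
by rewrite normcX normc_circle_pt expr1n.
Qed.

Lemma unconditional_finite (U : completeNormedModType R[i]) (D : set nat)
    (u : nat -> U) (c : R) (n : nat) (u' : 'I_n -> U) :
  0 <= c -> (forall k, u' k = if `[< D k >] then u k else 0) ->
  (forall (N : nat) (a eps : nat -> R[i]),
    coefs_on D a -> (forall n, `|eps n| = 1) ->
    rnorm (\sum_(n < N) eps n *: (a n *: u n)) <= c * rnorm (\sum_(n < N) a n *: u n)) ->
  forall a b : 'I_n -> R[i], (forall k, normc (b k) <= normc (a k)) ->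
  rnorm (\sum_k b k *: u' k) <= 2 * c * rnorm (\sum_k a k *: u' k).
Proof.
move=> c0 u'E hc a b ba; apply: unconditional_multiplier => // {ba b}a eps eps1.
pose a' (j : nat) : R[i] := if insub j is Some k then (if `[< D j >] then a k else 0) else 0.
pose eps' (j : nat) : R[i] := if insub j is Some k then eps k else 1.
have a'D : coefs_on D a'.
  by move=> j Dj; rewrite /a'; case: insub => // k; rewrite asboolF.
have e'1 j : `|eps' j| = 1.
  by rewrite /eps' normcEC; case: insub => [k|]; rewrite ?eps1 ?normc1.
have E (k : 'I_n) : a' k *: u k = a k *: u' k.
  by rewrite /a' u'E valK; case: ifP; rewrite ?scale0r ?scaler0.
have := hc n a' eps' a'D e'1.
under eq_bigr do rewrite E /eps' valK.
by under [X in _ <= _ * rnorm X -> _]eq_bigr do rewrite E.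
Qed.

(** The vectors T (x j) may have infinite expansions, whereas the previous estimate is for finitely
    many coordinates. They are truncated, at the price of [delta] and of the factor 2 in front. *)
Lemma lust_estimate (lam C delta : R) (x : I -> X) :
  0 < lam -> 0 < C -> 0 < delta -> sign_cotype X q C ->
  (exists (U : completeNormedModType R[i]) (D : set nat) (u : nat -> U)
           (T : X -> U) (S : U -> X),
      [/\ unconditional_basis D u,
          bounded_operator (span x) T,
          bounded_operator setT S,
          forall y, span x y -> S (T y) = y &
          (opnorm (span x) T * opnorm setT S * unconditional_constant D u
             <= lam%:E)%E]) ->
  \sum_j rnorm (x j) `^ q <= square_function_const q C *
    (2 * (8 * (lam + 1) ^+ 3 * 6 ^+ m *
     ((\sum_(w : W) rnorm (\sum_j grid_monomial w (expo e j) *: x j)) / #|{: W}|%:R)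
     + delta)) `^ q.
Proof.
move=> lam0 C0 delta0 hC [U [D [u [T [S [[hschauder _] [Tlin Tfin] [Slin Sfin] ST hlam]]]]]].
set avg := _ / _; set B := _ + delta.
have q0 : 0 < q by apply: lt_le_trans q2.
have W0 : 0 < #|{: W}|%:R :> R by rewrite ltr0n card_ffun expn_gt0 card_ord.
have avg0 : 0 <= avg by rewrite divr_ge0// sumr_ge0// => w _; exact: rnorm_ge0.
have lam1 : 0 <= lam + 1 by rewrite addr_ge0// ltW.
have B0 : 0 < B.
  by apply: ltr_wpDl => //; do 2![apply: mulr_ge0 => //]; rewrite ?exprn_ge0// mulr_ge0 ?exprn_ge0.
have K0 := square_function_const_ge0 q C0.
(* A nonzero x j is what yields t * s >= 1 from S T = id; this makes the unconditional constant
   finite and bounds c by t * s * c. *)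
have [j0 xj0|x0] := pickP (fun j => rnorm (x j) != 0); last first.
  rewrite big1 => [|j _]; first by apply: mulr_ge0 => //; exact: powR_ge0.
  by have /negbFE/eqP -> := x0 j; rewrite powR0// gt_eqF.
have xj0p : 0 < rnorm (x j0) by rewrite lt_neqAle eq_sym xj0 rnorm_ge0.
have F0 := span0 x; have Flin := @span_lin _ _ _ x; have Fx := span_mem x.
have T0 := opnorm_ge0 F0 Tlin.
have S0 : (0 <= opnorm setT S)%E by apply: opnorm_ge0.
have fT : opnorm (span x) T \is a fin_num by rewrite ge0_fin_numE.
have fS : opnorm setT S \is a fin_num by rewrite ge0_fin_numE.
pose t := fine (opnorm (span x) T); pose s := fine (opnorm setT S).
have t0 : 0 <= t by exact: fine_ge0.
have s0 : 0 <= s by exact: fine_ge0.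
have Tb : forall y, span x y -> rnorm (T y) <= t * rnorm y.
  by apply: opnorm_bound => //; rewrite /t fineK.
have Sb : forall y, rnorm (S y) <= s * rnorm y.
  by move=> y; apply: (opnorm_bound (F := setT)) => //; rewrite /s fineK.
have st1 : 1 <= t * s.
  rewrite -(ler_pM2r xj0p) mul1r -{1}(ST (x j0))//.
  by apply: le_trans (Sb _) _; rewrite mulrAC [leRHS]mulrC ler_wpM2l// Tb.
have ts0 : 0 < t * s by apply: lt_le_trans st1.
have [c [c0 hc] tsc] : exists2 c : R, 0 <= c /\
    forall (N : nat) (a eps : nat -> R[i]),
      coefs_on D a -> (forall n, `|eps n| = 1) ->
      rnorm (\sum_(n < N) eps n *: (a n *: u n)) <=
      c * rnorm (\sum_(n < N) a n *: u n) & t * s * c <= lam + 1.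
  have fU : unconditional_constant D u \is a fin_num.
    rewrite ge0_fin_numE ?unconditional_constant_ge0// ltey.
    apply: contraTneq hlam => ->.
    by rewrite -(fineK fT) -(fineK fS) -EFinM gt0_muley ?lte_fin// leye_eq.
  (* The infimum is approached within 1 / (t s), which turns the bound lam into lam + 1. *)
  have i0 : 0 < (t * s)^-1 by rewrite invr_gt0.
  have [_ [c hc <-]] := lb_ereal_inf_adherent i0 fU.
  rewrite -/(unconditional_constant D u) => clt.
  exists c => //; move: hlam clt.
  rewrite -(fineK fT) -(fineK fS) -(fineK fU) -!EFinM -EFinD lee_fin lte_fin.
  rewrite -/t -/s; move: (fine _) => r tsr /ltW cr.
  apply: le_trans (ler_wpM2l (ltW ts0) cr) _.
  by rewrite mulrDr divff ?gt_eqF// lerD2r.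
have c_le : c <= lam + 1 by apply: le_trans tsc; rewrite ler_peMl.
pose L := s * (2 * c) ^+ 3 * 6 ^+ m.
have L0 : 0 <= L by rewrite !mulr_ge0 ?exprn_ge0// mulr_ge0.
(* Only the product t s c is controlled, so c^3 is split as c times c^2: the first factor joins t s,
   the other two use c <= lam + 1. *)
have Lt : L * t <= 8 * (lam + 1) ^+ 3 * 6 ^+ m.
  have -> : L * t = 8 * ((t * s * c) * c ^+ 2) * 6 ^+ m by rewrite /L; ring.
  rewrite ler_wpM2r ?exprn_ge0// ler_wpM2l// [(lam + 1) ^+ 3]exprS.
  apply: ler_pM; rewrite ?exprn_ge0//; first by rewrite !mulr_ge0.
  by rewrite lerXn2r ?nnegrE.
have [a ha] := choice (fun j => let: ex_intro a (conj h _) :=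
   hschauder (T (x j)) in ex_intro _ a h).
pose E := delta / (L * #|I|%:R + 1).
have LI0 : 0 < L * #|I|%:R + 1 by rewrite ltr_wpDl// mulr_ge0.
have E0 : 0 < E by rewrite divr_gt0.
(* The bound [E] keeps the total error L #|I| E below [delta]. The second bound gives s eps_j <= |x
   j| / 2, hence |x j| <= 2 |S (tr n j)|; the added 1 keeps the denominator positive. *)
pose eps j : R := if rnorm (x j) == 0 then E else Num.min E (rnorm (x j) / (2 * (s + 1))).
have s1 : 0 < 2 * (s + 1) by rewrite mulr_gt0// ltr_wpDl.
have eps0 j : 0 < eps j.
  rewrite /eps; case: eqP => // /eqP xj.
  by rewrite lt_min E0 divr_gt0// lt_neqAle eq_sym xj rnorm_ge0.
have epsE j : eps j <= E by rewrite /eps; case: eqP => // _; rewrite ge_min lexx.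
pose tr n j := \sum_(k < n) a j k *: u k.
have [n hn] : exists n, forall j, rnorm (tr n j - T (x j)) <= eps j.
  have hj j : exists N, forall n, (N <= n)%N -> rnorm (tr n j - T (x j)) <= eps j.
    have [_ /cvgrPdist_le /(_ (eps j)%:C%C)] := ha j.
    rewrite ltcR => /(_ (eps0 j)) [N _ hN]; exists N => n Nn.
    have := hN n Nn; rewrite rnormE lecR -rnormN opprB.
    by rewrite /series/= big_mkord.
  have [N hN] := choice hj.
  exists (\sum_j N j)%N => j; apply: hN.
  by rewrite (bigD1 j)//= leq_addr.
pose u' (k : 'I_n) := if `[< D k >] then u k else 0.
have trE j : \sum_(k < n) a j k *: u' k = tr n j.
  apply: eq_bigr => k _; rewrite /u'; case: asboolP => // Dk.
  by have [aD _] := ha j; rewrite aD// !scale0r.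
have Ssum (b : 'I_n -> R[i]) : S (\sum_k b k *: u' k) = \sum_k b k *: S (u' k).
  by have [] := @linear_on_sum _ _ _ setT S _ _ Slin _ (index_enum _) b u' _.
have c20 : 0 <= 2 * c by rewrite mulr_ge0.
have main : \sum_j rnorm (S (tr n j)) `^ q <= square_function_const q C * B `^ q.
  under eq_bigr do rewrite -trE.
  apply: (lattice_estimate q2 c20 s0 _ Ssum Sb einj em m0 C0 B0 hC).
    exact: (unconditional_finite c0 (fun=> erefl) hc).
  rewrite -/L.
  have pw (w : W) : rnorm (\sum_(k < n) (\sum_j a j k * grid_monomial w (expo e j)) *: u' k) <=
      t * rnorm (\sum_j grid_monomial w (expo e j) *: x j) + #|I|%:R * E.
    have -> : \sum_(k < n) (\sum_j a j k * grid_monomial w (expo e j)) *: u' k =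
        \sum_j grid_monomial w (expo e j) *: tr n j.
      under eq_bigr do rewrite scaler_suml.
      rewrite exchange_big/=; apply: eq_bigr => j _; rewrite -trE scaler_sumr.
      by apply: eq_bigr => k _; rewrite scalerA mulrC.
    rewrite [X in rnorm X](_ : _ = \sum_j grid_monomial w (expo e j) *: T (x j) +
        \sum_j grid_monomial w (expo e j) *: (tr n j - T (x j))); last first.
      by rewrite -big_split; apply: eq_bigr => j _ /=; rewrite -scalerDr addrC subrK.
    apply: le_trans (rnormD _ _) _; apply: lerD.
      have [Fs <-] := linear_on_sum F0 Flin Tlin (index_enum I)
        (fun j => grid_monomial w (expo e j)) Fx.
      exact: Tb.
    apply: le_trans (rnorm_sum _ _ _) _.
    rewrite mulr_natl -sumr_const; apply: ler_sum => j _.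
    by rewrite rnormZ normc_grid_monomial mul1r; apply: le_trans (hn j) _.
  apply: (@le_trans _ _ (L * \sum_(w : W) (t * rnorm (\sum_j grid_monomial w (expo e j) *: x j)
      + #|I|%:R * E))).
    by rewrite ler_wpM2l//; apply: ler_sum => w _.
  rewrite big_split/= sumr_const -mulr_sumr mulrDr.
  rewrite /B mulrDl; apply: lerD.
    rewrite -[leRHS]mulrA /avg divfK ?gt_eqF//.
    by rewrite [leLHS]mulrA ler_wpM2r// sumr_ge0// => w _; exact: rnorm_ge0.
  rewrite -[(_ * E) *+ _]mulr_natr [leLHS]mulrA ler_wpM2r//.
  rewrite mulrA /E mulrA ler_pdivrMr// mulrC.
  by rewrite ler_wpM2l ?(ltW delta0)// lerDl.
have xtr j : rnorm (x j) <= 2 * rnorm (S (tr n j)).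
  have [->|xj] := eqVneq (rnorm (x j)) 0; first by rewrite mulr_ge0 ?rnorm_ge0.
  have xp : 0 < rnorm (x j) by rewrite lt_neqAle eq_sym xj rnorm_ge0.
  have h1 : rnorm (S (tr n j) - x j) <= s * eps j.
    rewrite -{1}(ST (x j))//.
    have -> : S (tr n j) - S (T (x j)) = S (tr n j - T (x j)).
      have := Slin (-1) (T (x j)) (tr n j) Logic.I Logic.I.
      by rewrite !scaleN1r addrC => ->; rewrite addrC.
    by apply: le_trans (Sb _) _; rewrite ler_wpM2l.
  have h2 : s * eps j <= rnorm (x j) / 2.
    apply: (@le_trans _ _ ((s + 1) * (rnorm (x j) / (2 * (s + 1))))).
      apply: ler_pM; rewrite ?(ltW (eps0 j))// ?lerDl//.
      by rewrite /eps (negbTE xj) ge_min lexx orbT.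
    by rewrite le_eqVlt; apply/orP; left; apply/eqP; field; rewrite gt_eqF// ltr_wpDl.
  have := rnormB (x j) (S (tr n j)); rewrite -(rnormN (x j - _)) opprB => h3.
  have := le_trans (ler_norm _) (le_trans h3 (le_trans h1 h2)); lra.
apply: (@le_trans _ _ (\sum_j 2 `^ q * rnorm (S (tr n j)) `^ q)).
  apply: ler_sum => j _; rewrite -powRM ?rnorm_ge0//.
  by apply: ge0_ler_powR; rewrite ?nnegrE ?mulr_ge0 ?rnorm_ge0 ?(ltW q0).
rewrite -mulr_sumr powRM ?(ltW B0)// mulrCA.
by rewrite ler_wpM2l ?powR_ge0.
Qed.

End lust_estimate.

(** * Multi-indices and the theorem *)

Section multi_indices.
Implicit Types a : multi_index.

Lemma big_multi_index (T : Type) (idx : T) (op : Monoid.com_law idx) (d : nat) a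
    (F : nat -> T) :
  (forall i, i \in finsupp a -> (i < d)%N) ->
  (forall i, a i = 0%N -> F i = idx) ->
  \big[op/idx]_(i <- finsupp a) F i = \big[op/idx]_(i < d) F i.
Proof.
move=> ad aF; rewrite -(big_mkord xpredT F) [RHS](bigID (mem (finsupp a)))/=.
rewrite [X in op _ X]big1 ?Monoid.mulm1; last first.
  by move=> i /fsfun_dflt; exact: aF.
rewrite -[RHS]big_filter; apply: perm_big; apply: uniq_perm.
- exact: fset_uniq.
- by rewrite filter_uniq// iota_uniq.
- move=> i; rewrite mem_filter mem_index_iota/=.
  by case: (boolP (i \in _)) => //= /ad ->.
Qed.

Lemma mi_degE (d : nat) a : (forall i, i \in finsupp a -> (i < d)%N) ->
  mi_deg a = (\sum_(i < d) a i)%N.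
Proof. by move=> ad; exact: big_multi_index. Qed.

Lemma mi_monomialE (R : realType) (d : nat) a (z : nat -> R[i]) :
  (forall i, i \in finsupp a -> (i < d)%N) ->
  mi_monomial z a = \prod_(i < d) z i ^+ a i.
Proof. by move=> ad; apply: big_multi_index => // i ->; rewrite expr0. Qed.

Lemma normc_mi_monomial (R : realType) (z : nat -> R[i]) a :
  (forall i, normc (z i) = 1) -> normc (mi_monomial z a) = 1.
Proof.
move=> z1; rewrite /mi_monomial normc_prod big1// => i _.
by rewrite normcX z1 expr1n.
Qed.

End multi_indices.

Lemma sqr_sum_le (R : realType) (I : finType) (a : I -> R) :
  (\sum_i a i) ^+ 2 <= #|I|%:R * \sum_i a i ^+ 2.
Proof.
have [I0|I0] := posnP #|I|.
  by rewrite I0 mul0r big1 ?expr0n// => i; have := card0_eq I0 i; rewrite inE.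
have N0 : 0 < #|I|%:R :> R by rewrite ltr0n.
pose mu := (\sum_i a i) / #|I|%:R.
have muE : \sum_i a i = mu * #|I|%:R by rewrite /mu divfK// gt_eqF.
have : 0 <= \sum_i (a i - mu) ^+ 2 by apply: sumr_ge0 => i _; exact: sqr_ge0.
have -> : \sum_i (a i - mu) ^+ 2 = \sum_i a i ^+ 2 - mu ^+ 2 * #|I|%:R.
  transitivity (\sum_i (a i ^+ 2 - 2 * mu * a i + mu ^+ 2)).
    by apply: eq_bigr => i _; ring.
  rewrite big_split/= big_split/= sumrN -mulr_sumr muE sumr_const -[_ *+ _]mulr_natr.
  by ring.
rewrite subr_ge0 muE -(ler_pM2l N0); apply: le_trans.
by rewrite le_eqVlt; apply/orP; left; apply/eqP; ring.
Qed.

Theorem theorem2p1 (R : realType) (X : completeNormedModType R[i]) (q : R)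
    (hq : 2 <= q) (hcotype : cotype X q)
    (hlust : local_unconditional_structure X) :
  hypercontractive_homogeneous_cotype X q.
Proof.
have [C0 C0p hC] := cotype_sign_cotype hq hcotype.
have [lam lam0 hlam] := hlust.
have q0 : 0 < q by apply: lt_le_trans hq.
pose K0 := square_function_const q C0.
pose L := 8 * (lam + 1) ^+ 3.
have L0 : 0 < L by rewrite mulr_gt0// exprn_gt0// addr_gt0.
pose M := K0 `^ q^-1 * 2 * L.
have M0 : 0 <= M.
  by apply: mulr_ge0 (ltW L0); apply: mulr_ge0 => //; exact: powR_ge0.
(* Since m >= 1, M 6^m <= (6 (1 + M))^m: the factor M, independent of m, is absorbed into the m-th
   power. *)
pose CC := 6 * (1 + M).
have M1 : 1 <= 1 + M by rewrite lerDl.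
have CC0 : 0 < CC by apply: mulr_gt0 => //; exact: lt_le_trans M1.
exists CC => //.
move=> m m0 x xm.
pose I : finType := finsupp x.
pose d := (\sum_(a <- finsupp x) \sum_(i <- finsupp a) i.+1)%N.
have ad (a : I) i : i \in finsupp (val a) -> (i < d)%N.
  move=> ia; rewrite /d (big_rem (val a)) ?fsvalP//= (big_rem i ia)/=.
  by rewrite -addnA addSn ltnS leq_addr.
have deg (a : I) : (\sum_(i < d) val a i)%N = m.
  by rewrite -(mi_degE (ad a)) xm// fsvalP.
have am (a : I) (i : 'I_d) : (val a i <= m)%N.
  by rewrite -(deg a) (bigD1 i)//= leq_addr.
pose e (a : I) : {ffun 'I_d -> 'I_(2 * m).+1} := [ffun i : 'I_d => inord (val a i)].
have eE (a : I) i : e a i = val a i :> nat.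
  by rewrite ffunE inordK// ltnS (leq_trans (am a i))// leq_pmull.
have einj : injective e.
  move=> a b ab; apply/val_inj/fsfunP => i.
  have [ia|/fsfun_dflt a0] := boolP (i \in finsupp (val a)).
    have := eE a (Ordinal (ad a i ia)); rewrite ab eE.
    by move=> <-.
  have [ib|/fsfun_dflt b0] := boolP (i \in finsupp (val b)); last by rewrite a0 b0.
  have := eE b (Ordinal (ad b i ib)); rewrite -ab eE.
  by move=> ->.
have em a : (\sum_i e a i)%N = m.
  by rewrite -[RHS](deg a); apply: eq_bigr => i _; exact: eE.
pose W : finType := {ffun 'I_d -> 'I_(2 * m).+1}.
have W0 : (0 < #|W|)%N by rewrite card_ffun expn_gt0 card_ord.
have W0' : 0 < #|W|%:R :> R by rewrite ltr0n.
pose Lq := \sum_(a : I) rnorm (x (val a)) `^ q.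
have LqE : \sum_(a <- finsupp x) rnorm (x a) `^ q = Lq by exact: big_seq_fsetE.
rewrite LqE; set f := (fun z : nat -> R[i] => _).
have fE z : f z = rnorm (\sum_(a : I) mi_monomial z (val a) *: x (val a)) ^+ 2.
  by rewrite /f big_seq_fsetE.
(* [d] exceeds every variable index that occurs, so it is enough to rotate the first d coordinates
   and fix the others. *)
pose s (w : W) (i : nat) : R := if insub i is Some k then (w k)%:R / (2 * m).+1%:R else 0.
have sE w (k : 'I_d) : circle_pt (s w k) = grid_pt w k :> R[i].
  by rewrite /s valK.
have monE (w : W) z (a : I) : mi_monomial (fun i => circle_pt (s w i) * z i) (val a) =
    grid_monomial w (expo e a) * mi_monomial z (val a).
  rewrite !(mi_monomialE _ (ad a)) /grid_monomial -big_split/=.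
  by apply: eq_bigr => i _; rewrite sE exprMn ffunE eE.
pose avg z := (\sum_(w : W) rnorm (\sum_(a : I) grid_monomial w (expo e a) *:
   (mi_monomial z (val a) *: x (val a)))) / #|W|%:R.
have avg0 z : 0 <= avg z by rewrite divr_ge0// sumr_ge0// => w _; exact: rnorm_ge0.
have key z : (forall i, normc (z i) = 1) -> Lq `^ q^-1 <= M * 6 ^+ m * avg z.
  (* The point z is absorbed into the coefficients without changing their norms; the grid average of
     the new polynomial is the average of the given one over rotations of z. *)
  move=> z1; pose y (a : I) := mi_monomial z (val a) *: x (val a).
  have est delta : 0 < delta -> Lq `^ q^-1 <= K0 `^ q^-1 * (2 * (L * 6 ^+ m * avg z + delta)).
    move=> dl0.
    have B0 : 0 <= 2 * (L * 6 ^+ m * avg z + delta).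
      apply: mulr_ge0 => //; apply: addr_ge0 (ltW dl0); apply: mulr_ge0 => //.
      by apply: mulr_ge0 (ltW L0) _; exact: exprn_ge0.
    have := lust_estimate hq einj em m0 lam0 C0p dl0 hC (hlam _ (finite_dim_span y)).
    rewrite -/K0 -/L.
    rewrite [X in X <= _ -> _](_ : _ = Lq); last first.
      by apply: eq_bigr => a _; rewrite rnormZ normc_mi_monomial// mul1r.
    have K00 : 0 <= K0 by exact: square_function_const_ge0.
    have qi0 : 0 <= q^-1 by rewrite invr_ge0 ltW.
    move=> /(ge0_ler_powR qi0); rewrite !nnegrE.
    have -> : 0 <= Lq by apply: sumr_ge0 => a _; exact: powR_ge0.
    rewrite mulr_ge0 ?powR_ge0// => /(_ isT isT) /le_trans; apply.
    by rewrite powRM ?powR_ge0// -powRrM divff ?gt_eqF// powRr1.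
  apply/ler_addgt0Pr => e0 e0p.
  pose G := K0 `^ q^-1 * 2 + 1.
  have G0 : 0 < G by rewrite ltr_wpDl// mulr_ge0 ?powR_ge0.
  have dp : 0 < e0 / G by rewrite divr_gt0.
  apply: le_trans (est _ dp) _.
  have -> : K0 `^ q^-1 * (2 * (L * 6 ^+ m * avg z + e0 / G)) =
     M * 6 ^+ m * avg z + (K0 `^ q^-1 * 2) * (e0 / G) by rewrite /M; ring.
  rewrite lerD2l mulrA ler_pdivrMr// mulrC ler_wpM2l ?(ltW e0p)//.
  by rewrite /G lerDl.
pose Kc := CC ^+ m.
have Kc0 : 0 < Kc by exact: exprn_gt0.
have MKc : M * 6 ^+ m <= Kc.
  rewrite /Kc /CC exprMn mulrC ler_wpM2l ?exprn_ge0//.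
  apply: (@le_trans _ _ (1 + M)); first by rewrite lerDr.
  by rewrite ler_eXnr.
(* The value of the integral at which the claimed inequality becomes an equality. *)
pose A := (Lq `^ q^-1 / Kc) ^+ 2.
have AI : (A%:E <= torus_int f)%E.
  have mmon (g : nat -> cube nat R -> R[i]) a : (forall i, cmeasurable (g i)) ->
      cmeasurable (fun t => mi_monomial (fun i => g i t) a).
    by move=> mg; apply: cmeasurable_prod => i; exact: cmeasurableX.
  apply: (torus_int_ge (s := s)) => //.
  - move=> w i; rewrite /s; case: insubP => [k _ _|_]; last by rewrite lexx ltr01.
    by rewrite divr_ge0//= ltr_pdivrMr// mul1r ltr_nat.
  - by move=> z; exact: sqr_ge0.
  - apply: measurable_funX; apply: measurable_rnorm_sum => a.
    by apply: mmon => i; exact: cmeasurable_circle_pt.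
  - move=> w; apply: measurable_funX.
    apply: (@measurable_rnorm_sum _ _ _ _ _ _ (fun a (t : cube nat R) =>
      mi_monomial (fun i => circle_pt (s w i) * circle_pt (t i)) a)) => a.
    apply: (mmon (fun i t => circle_pt (s w i) * circle_pt (t i))) => i.
    by apply: cmeasurableM; [exact: cmeasurable_cst|exact: cmeasurable_circle_pt].
  - exact: sqr_ge0.
  move=> z z1.
  have -> : \sum_(w : W) f (fun i => circle_pt (s w i) * z i) =
     \sum_(w : W) rnorm (\sum_(a : I) grid_monomial w (expo e a) *:
       (mi_monomial z (val a) *: x (val a))) ^+ 2.
    apply: eq_bigr => w _; rewrite fE; congr (rnorm _ ^+ 2).
    by apply: eq_bigr => a _; rewrite monE scalerA.
  (* The bound at z involves the mean of the norms over the grid; Cauchy-Schwarz passes to the mean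
     of their squares. *)
  have cs := sqr_sum_le (fun w : W => rnorm (\sum_(a : I) grid_monomial w (expo e a) *:
       (mi_monomial z (val a) *: x (val a)))).
  rewrite -(ler_pM2l W0'); apply: le_trans cs.
  rewrite (_ : _ * (A * _) = (Lq `^ q^-1 / Kc * #|W|%:R) ^+ 2); last by rewrite /A; ring.
  rewrite lerXn2r ?nnegrE ?mulr_ge0 ?powR_ge0 ?invr_ge0 ?(ltW Kc0)//.
    by rewrite sumr_ge0// => w _; exact: rnorm_ge0.
  rewrite -ler_pdivlMr// ler_pdivrMr// mulrC; apply: le_trans (key z z1) _.
  by rewrite ler_wpM2r.
have Ah : A `^ 2^-1 = Lq `^ q^-1 / Kc.
  by rewrite powR12_sqrt ?sqr_ge0// sqrtr_sqr ger0_norm// divr_ge0 ?powR_ge0// ltW.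
have -> : ((Lq `^ q^-1)%:E = Kc%:E * (A `^ 2^-1)%:E)%E.
  by rewrite -EFinM Ah mulrC divfK// gt_eqF.
rewrite lee_wpmul2l ?lee_fin ?(ltW Kc0)// -poweR_EFin.
apply: gt0_ler_poweR => //; rewrite in_itv/= leey andbT ?lee_fin ?sqr_ge0//.
by apply: le_trans AI; rewrite lee_fin sqr_ge0.
Qed.
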